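(* Let $d=2$, let $r_g<r_{\min}\le r_{\max}$ be constants and $r=r(n)\in[r_{\min},r_{\max}]$. There exist constants $C$ and $c>0$ such that, with high probability as $n\to\infty$, every $A\subset L_1(G)$ with $\pi(A)\ge\frac{C(\log n)^2}{n}$ contains two vertices at (toroidal Euclidean) distance at least $c\sqrt{\deg(A)}$.
   Context: $\Lambda_n^{(2)}$ is the torus $\left[-\frac{\sqrt n}{2},\frac{\sqrt n}{2}\right]^2$; $G$ is the random geometric graph whose vertices form a Poisson point process of intensity $1$ on $\Lambda_n^{(2)}$, with edges between vertices at Euclidean distance at most $r(n)$. $r_g$ is the critical radius above which $G$ has, with high probability, a unique component of size of order $n$, the giant component $L_1(G)$. $\deg(A)=\sum_{x\in A}\deg(x)$ and $\pi(A)=\deg(A)/\deg(L_1(G))$ is the stationary measure of the simple random walk on $L_1(G)$. ''With high probability'' means with probability tending to $1$ as $n\to\infty$. *)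

(* Defs.v *)
From HB Require Import structures.
From mathcomp Require Import all_boot all_order all_algebra.
From mathcomp Require Import all_classical all_reals all_analysis.
From mathcomp Require Import poisson_distribution.

Set Implicit Arguments.
Unset Strict Implicit.
Unset Printing Implicit Defensive.

Import Order.TTheory GRing.Theory Num.Theory.
Import numFieldNormedType.Exports.

Local Open Scope classical_set_scope.
Local Open Scope ring_scope.

Section RGG.
Variable R : realType.

Definition side (n : nat) : R := Num.sqrt n%:R.

(* the fundamental box [-L/2, L/2)^2 of the torus, one coordinate *)
Definition box (L : R) : set R := `[- (L / 2), L / 2[%classic.

Definition tcoord (L t : R) : R := Num.min `|t| (L - `|t|).

Definition tdist (L : R) (p q : R * R) : R :=
  Num.sqrt (tcoord L (p.1 - q.1) ^+ 2 + tcoord L (p.2 - q.2) ^+ 2).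

Fixpoint iint (L : R) (k : nat) (f : seq (R * R) -> \bar R) : \bar R :=
  match k with
  | 0 => f [::]
  | k'.+1 =>
      (\int[lebesgue_measure]_(x in box L)
         \int[lebesgue_measure]_(y in box L)
            iint L k' (fun s => f ((x, y) :: s)))%E
  end.

(* Probability of an event E (a property of the finite point configuration)
   for the Poisson point process of intensity 1 on the torus of area n:
   the number of points is Poisson(n), and given it equals k, the points are
   i.i.d. uniform on the box (density n^-1 each). *)
Definition ppp_prob (n : nat) (E : seq (R * R) -> Prop) : \bar R :=
  (\sum_(k <oo)
     ((poisson_pmf (n%:R : R) k) * (n%:R ^- k))%:E
       * iint (side n) k (fun s => (`[< E s >])%:R%:E))%E.

Section Graph.
Variables (L r : R) (s : seq (R * R)).

Definition pos (i : 'I_(size s)) : R * R := nth (0, 0) s i.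

Definition adj : rel 'I_(size s) :=
  fun i j => (i != j) && (tdist L (pos i) (pos j) <= r).

Definition deg (i : 'I_(size s)) : nat := #|[set j | adj i j]|.

Definition degA (A : {set 'I_(size s)}) : nat := (\sum_(i in A) deg i)%N.

Definition comp (i : 'I_(size s)) : {set 'I_(size s)} :=
  [set j | connect adj i j].

(* L_1(G): a largest connected component (set0 if there is no vertex) *)
Definition giant : {set 'I_(size s)} :=
  odflt (finset.set0 : {set 'I_(size s)}) [pick C : {set 'I_(size s)} |
     [exists i, C == comp i] && [forall i, (#|comp i| <= #|C|)%N] ].

(* stationary measure of simple random walk on L_1(G) *)
Definition piA (A : {set 'I_(size s)}) : R :=
  (degA A)%:R / (degA giant)%:R.

End Graph.

Arguments pos : clear implicits.
Arguments adj : clear implicits.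
Arguments deg : clear implicits.
Arguments degA : clear implicits.
Arguments comp : clear implicits.
Arguments giant : clear implicits.
Arguments piA : clear implicits.

Definition giant_regime (r0 : R) : Prop :=
  exists delta : R, 0 < delta /\
    forall eps : R, 0 < eps ->
      (fun n : nat => ppp_prob n (fun s =>
          delta * n%:R <= #|giant (side n) r0 s|%:R /\
          forall i, i \notin giant (side n) r0 s ->
                    #|comp (side n) r0 s i|%:R <= eps * n%:R))
      @ \oo --> 1%E.

Definition r_g : R :=
  inf [set r0 : R | 0 < r0 /\ forall r', r0 <= r' -> giant_regime r'].

Definition diam_event (n : nat) (r C c : R) (s : seq (R * R)) : Prop :=
  forall A : {set 'I_(size s)},
    A \subset giant (side n) r s ->
    C * (ln (n%:R : R)) ^+ 2 / n%:R <= piA (side n) r s A ->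
    exists u v, u \in A /\ v \in A /\
      c * Num.sqrt (degA (side n) r s A)%:R <= tdist (side n) (pos s u) (pos s v).

End RGG.

(* Main.v *)
Require Import Defs.
From HB Require Import structures.
From mathcomp Require Import all_boot all_order all_algebra.
From mathcomp Require Import all_classical all_reals all_analysis.
From mathcomp Require Import measurable_realfun poisson_distribution zify ring lra.
Set Implicit Arguments.
Unset Strict Implicit.
Unset Printing Implicit Defensive.
Import Order.TTheory GRing.Theory Num.Theory.
Import numFieldNormedType.Exports.
Local Open Scope classical_set_scope.
Local Open Scope ring_scope.

(** Every expectation needed is that of a product functional
    [\prod_(x in s) F (cell x)] over a grid of cells, which for a Poisson
    process is the explicit number [exp (area * \sum_c (F c - 1))]; bad events
    are dominated by finite sums of such functionals.

    Degrees: with cells of side about [rmax] and [N_c] points in the cell [c],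
    a set [A] lying in a window of cells has [deg A <= 18 \sum_c N_c^2], the sum
    running over a slightly larger window.  With high probability all [N_c] are
    at most [2 ln n], so [exp (N_c^2 / (2 ln n))] is dominated by
    [1 + (2 / ln n) exp (2 N_c)], and a Chernoff bound gives
    [\sum_c N_c^2 = O (m^2 + (ln n)^2)] for all windows of side [m].  Since the
    giant component has total degree of order [n], [A] of diameter less than
    [c sqrt (deg A)] would violate this bound.

    The infimum of the empty set is [0], so the argument also has to exhibit a
    radius above which the giant regime holds.  This is done by a hierarchical
    renormalization which avoids planar duality: a box of level [j + 1] is bad
    if its [3 x 3] neighbourhood contains two bad boxes of level [j] far from
    each other.  Then the bad sub-boxes near a good box lie in one small
    window, whose complement in a rectangle is connected by rows and columns, so
    the cores of neighbouring good boxes are connected, and a path leaving the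
    neighbourhood of a good box must meet its core.  A bad box of level [k]
    contains [2 ^ k] distinct empty cells chosen among at most [A ^ (2 ^ k)]
    configurations, so for large radii there is no bad box of level about
    [log log n]; then every component other than that of the cores is
    contained in a [3 x 3] block of such boxes. *)

(** * Integrals of nonnegative functions, measurable or not *)

Section LowerIntegral.
Context d (T : measurableType d) (R : realType).
Variable mu : {measure set T -> \bar R}.
Variables (D : set T) (mD : measurable D).
Local Open Scope ereal_scope.
Import HBNNSimple.

(** The integral of a nonnegative function is a supremum over simple functions below it, so
    monotonicity holds for arbitrary functions, in particular for indicators of arbitrary events. *)
Lemma le_lower_integral (f g : T -> \bar R) :
  (forall x, D x -> 0 <= f x) -> (forall x, D x -> f x <= g x) ->
  \int[mu]_(x in D) f x <= \int[mu]_(x in D) g x.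
Proof.
move=> f0 fg; have g0 x : D x -> 0 <= g x.
  by move=> Dx; exact: le_trans (f0 _ Dx) (fg _ Dx).
rewrite !ge0_integralE//; apply: ge_ereal_sup => _ [h /= hf <-].
apply: ereal_sup_ubound; exists h => //= x; apply: le_trans (hf x) _.
by rewrite /patch; case: ifPn => // /set_mem /fg.
Qed.

(** Subadditivity with [g] measurable and [f] arbitrary: for a simple [h] below [f + g], the
    positive part of [h - g] is measurable, lies below [f], and together with [g] dominates [h]. *)
Lemma lower_integralD_le (f : T -> \bar R) (g : T -> R) :
  (forall x, D x -> 0 <= f x) -> (forall x, D x -> (0 <= g x)%R) ->
  measurable_fun D g ->
  \int[mu]_(x in D) (f x + (g x)%:E) <=
  \int[mu]_(x in D) f x + \int[mu]_(x in D) (g x)%:E.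
Proof.
move=> f0 g0 mg; have fg0 x : D x -> 0 <= f x + (g x)%:E.
  by move=> Dx; rewrite adde_ge0 ?f0// lee_fin g0.
rewrite ge0_integralE//; apply: ge_ereal_sup => _ [h /= hf <-].
have hD x : ~ D x -> h x = 0%R.
  move=> nDx; apply/eqP; rewrite eq_le fun_ge0 andbT -lee_fin.
  by have := hf x; rewrite /patch memNset.
have -> : sintegral mu h = \int[mu]_(x in D) (h x)%:E.
  rewrite integral_nnsfun//; congr sintegral; apply/funext => x.
  by rewrite /patch; case: ifPn => // /negP nDx; apply: hD => /mem_set.
have mh : measurable_fun D (EFin \o h).
  by apply/measurable_EFinP; apply: measurable_funTS.
have mg' : measurable_fun D (EFin \o g) by exact/measurable_EFinP.
pose w x := maxe ((h x)%:E - (g x)%:E) 0.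
have mw : measurable_fun D w.
  by apply: measurable_maxe => //; exact: emeasurable_funB.
have w0 x : D x -> 0 <= w x by move=> _; rewrite /w le_max lexx orbT.
apply: (@le_trans _ _ (\int[mu]_(x in D) (w x + (g x)%:E))).
  apply: le_lower_integral => x Dx; first by rewrite lee_fin.
  rewrite /w; apply: (@le_trans _ _ ((h x)%:E - (g x)%:E + (g x)%:E)).
    by rewrite -EFinB -EFinD subrK.
  by apply: leeD => //; rewrite le_max lexx.
rewrite ge0_integralD//; apply: leeD => //.
apply: le_lower_integral => // x Dx; rewrite /w ge_max f0// andbT.
rewrite leeBlDr//.
by have := hf x; rewrite /patch mem_set.
Qed.

End LowerIntegral.

(** * Product functionals of a Poisson process and their expectations *)

Section ProductFunctionals.
Variable R : realType.
Implicit Types (L : R) (Q : nat) (F : nat -> nat -> R) (s : seq (R * R)).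

Definition cell L Q (x : R) : nat := Num.truncn ((x + L / 2) * Q%:R / L).

Definition prodF L Q F s : R :=
  \prod_(p <- s) F (cell L Q p.1) (cell L Q p.2).

Definition sumF Q F : R := \sum_(i < Q) \sum_(j < Q) F i j.

Definition in_box L s := forall p, p \in s -> box L p.1 /\ box L p.2.

Lemma cell_itv L Q (x : R) : 0 < L -> (0 < Q)%N -> box L x ->
  (cell L Q x)%:R <= (x + L / 2) * Q%:R / L < (cell L Q x).+1%:R.
Proof.
move=> L0 Q0; rewrite /box /= in_itv /= => /andP[x1 x2]; apply: truncn_itv.
by apply: divr_ge0; [apply: mulr_ge0; [lra|exact: ler0n]|exact: ltW].
Qed.

Lemma cell_lt L Q (x : R) : 0 < L -> (0 < Q)%N -> box L x -> (cell L Q x < Q)%N.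
Proof.
move=> L0 Q0 bx; have /andP[c1 _] := cell_itv L0 Q0 bx.
move: bx; rewrite /box /= in_itv /= => /andP[x1 x2].
rewrite -(ltr_nat R); apply: le_lt_trans c1 _.
rewrite ltr_pdivrMr// mulrC ltr_pM2l ?ltr0n//; lra.
Qed.

Let mbox L : measurable (box L). Proof. exact: measurable_itv. Qed.

Definition strip L Q (i : nat) : set R :=
  `[- (L / 2) + i%:R * (L / Q%:R), - (L / 2) + i.+1%:R * (L / Q%:R)[%classic.

Lemma strip_sub L Q i : 0 < L -> (i < Q)%N -> strip L Q i `<=` box L.
Proof.
move=> L0 iQ x; rewrite /strip /box /= !in_itv /= => /andP[x1 x2].
have Q0 : 0 < Q%:R :> R by rewrite ltr0n (leq_ltn_trans _ iQ).
have h0 : 0 < L / Q%:R by rewrite divr_gt0.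
apply/andP; split.
  by apply: le_trans x1; rewrite lerDl mulr_ge0 ?ler0n ?ltW.
apply: lt_le_trans x2 _; have : i.+1%:R * (L / Q%:R) <= L.
  by rewrite mulrA ler_pdivrMr// mulrC ler_pM2l// ler_nat.
lra.
Qed.

Lemma lebesgue_measure_strip L Q i : 0 < L -> (0 < Q)%N ->
  lebesgue_measure (strip L Q i) = (L / Q%:R)%:E.
Proof.
move=> L0 Q0; rewrite /strip lebesgue_measure_itv /= lte_fin ltrD2l.
rewrite ltr_pM2r ?divr_gt0 ?ltr0n// ltr_nat ltnSn -EFinB; congr EFin.
rewrite -[i.+1]addn1 natrD; ring.
Qed.

Lemma in_strip L Q (x : R) i : 0 < L -> (0 < Q)%N -> box L x ->
  (x \in strip L Q i) = (cell L Q x == i).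
Proof.
move=> L0 Q0 bx; have Q0' : 0 < Q%:R :> R by rewrite ltr0n.
have x0 : 0 <= (x + L / 2) * Q%:R / L.
  move: bx; rewrite /box /= in_itv /= => /andP[x1 x2].
  by apply: divr_ge0; [apply: mulr_ge0; [lra|exact: ler0n]|exact: ltW].
rewrite /cell (truncn_eq _ x0) /strip mem_setE in_itv /=.
rewrite ler_pdivlMr// ltr_pdivrMr// -[in RHS]ler_pdivrMr// -[in RHS]ltr_pdivlMr//.
rewrite !mulrA -lerBrDl opprK -ltrBlDl opprK.
by congr (_ && _).
Qed.

(** Writing a function of the cell as a simple function over the strips gives both its measurability
    and its integral. *)
Lemma comp_cellE L Q (psi : nat -> R) x : 0 < L -> (0 < Q)%N -> box L x ->
  psi (cell L Q x) = \sum_(i < Q) psi i * \1_(strip L Q i) x.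
Proof.
move=> L0 Q0 bx; rewrite (bigD1 (Ordinal (cell_lt L0 Q0 bx)))//=.
rewrite indicE in_strip// eqxx mulr1 big1 ?addr0// => i ne.
rewrite indicE in_strip//; case: eqP => [e|]; last by rewrite mulr0.
by case/eqP: ne; apply: val_inj.
Qed.

Lemma measurable_comp_cell L Q (psi : nat -> R) : 0 < L -> (0 < Q)%N ->
  measurable_fun (box L) (fun x => psi (cell L Q x)).
Proof.
move=> L0 Q0.
apply: (@eq_measurable_fun _ _ _ _ _ (fun x => \sum_(i < Q) psi i * \1_(strip L Q i) x)).
  by move=> x /set_mem bx; rewrite -comp_cellE.
apply: measurable_sum => i; apply: measurable_funM => //.
exact: measurable_funTS (measurable_indic (measurable_itv _)).
Qed.

Lemma integral_comp_cell L Q (psi : nat -> R) : 0 < L -> (0 < Q)%N ->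
  (forall i, 0 <= psi i) ->
  (\int[lebesgue_measure]_(x in box L) (psi (cell L Q x))%:E =
   (L / Q%:R * \sum_(i < Q) psi i)%:E)%E.
Proof.
move=> L0 Q0 p0.
transitivity (\int[lebesgue_measure]_(x in box L)
    (\sum_(i < Q) (psi i)%:E * (\1_(strip L Q i) x)%:E))%E.
  apply: eq_integral => x /set_mem bx; rewrite (comp_cellE psi L0 Q0 bx) -sumEFin.
  by apply: eq_bigr => i _; rewrite EFinM.
have mS i : measurable (strip L Q i) by exact: measurable_itv.
have mI i : measurable_fun (box L) (EFin \o (\1_(strip L Q i) : R -> R)).
  by apply/measurable_EFinP; apply: measurable_funTS; exact: measurable_indic.
rewrite ge0_integral_sum//; last 3 first.
- exact: mbox.
- by move=> i; apply: measurable_funeM; exact: mI.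
- by move=> i x _; rewrite mule_ge0// lee_fin.
rewrite mulr_sumr -sumEFin; apply: eq_bigr => i _.
rewrite ge0_integralZl_EFin//; last 2 first.
- exact: mbox.
- exact: mI.
rewrite integral_indic; last 2 first.
- exact: mbox.
- exact: mS.
rewrite setIidl; last exact: strip_sub.
transitivity ((psi i)%:E * (L / Q%:R)%:E)%E; last by rewrite -EFinM mulrC.
by congr (_ * _)%E; exact: lebesgue_measure_strip.
Qed.

Lemma box_integralD_le L (f : R -> \bar R) (g : R -> R) :
  (forall x, box L x -> (0 <= f x)%E) -> (forall x, box L x -> 0 <= g x) ->
  measurable_fun (box L) g ->
  (\int[lebesgue_measure]_(x in box L) (f x + (g x)%:E) <=
   \int[lebesgue_measure]_(x in box L) f x +
   \int[lebesgue_measure]_(x in box L) (g x)%:E)%E.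
Proof.
move=> f0 g0 mg; apply: lower_integralD_le => //; exact: mbox.
Qed.

Lemma iint_ge0 L k (f : seq (R * R) -> \bar R) :
  (forall s, (0 <= f s)%E) -> (0 <= iint L k f)%E.
Proof.
elim: k f => [|k IH] f f0 //=.
by apply: integral_ge0 => x _; apply: integral_ge0 => y _; exact: IH.
Qed.

Lemma le_iint L k (f g : seq (R * R) -> \bar R) :
  (forall s, (0 <= f s)%E) -> (forall s, in_box L s -> (f s <= g s)%E) ->
  (iint L k f <= iint L k g)%E.
Proof.
elim: k f g => [|k IH] f g f0 fg /=; first by apply: fg.
apply: le_lower_integral => [x _|x bx].
  by apply: integral_ge0 => y _; exact: iint_ge0.
apply: le_lower_integral => [y _|y By]; first exact: iint_ge0.
apply: IH => // s bs; apply: fg => p; rewrite inE => /predU1P[->|]//.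
exact: bs.
Qed.

Lemma prodF_ge0 L Q F s : (forall i j, 0 <= F i j) -> 0 <= prodF L Q F s.
Proof. by move=> F0; apply: prodr_ge0. Qed.

(** Subadditivity is applied in each of the [2 * k] integrals, [f] being arbitrary. The constant [c]
    is general because the factor of the first point is absorbed into it before the induction
    hypothesis is used. *)
Lemma iint_addM_le L Q F (c : R) k (f : seq (R * R) -> \bar R) :
  0 < L -> (0 < Q)%N -> (forall i j, 0 <= F i j) -> 0 <= c ->
  (forall s, (0 <= f s)%E) ->
  (iint L k (fun s => f s + (c * prodF L Q F s)%:E) <=
   iint L k f + (c * ((L / Q%:R) ^+ 2 * sumF Q F) ^+ k)%:E)%E.
Proof.
move=> L0 Q0 F0; elim: k c f => [|k IH] c f c0 f0 /=.
  by rewrite /prodF big_nil expr0.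
set a := (L / Q%:R) ^+ 2 * sumF Q F.
have a0 : 0 <= a.
  by rewrite mulr_ge0 ?exprn_ge0 ?divr_ge0 ?ler0n ?(ltW L0)// !sumr_ge0// => *; exact: sumr_ge0.
have ca0 : 0 <= c * a ^+ k by rewrite mulr_ge0// exprn_ge0.
have inner x : (\int[lebesgue_measure]_(y in box L)
     iint L k (fun s => f ((x, y) :: s) + (c * prodF L Q F ((x, y) :: s))%:E) <=
   \int[lebesgue_measure]_(y in box L) iint L k (fun s => f ((x, y) :: s)) +
   (c * a ^+ k * (L / Q%:R * \sum_(j < Q) F (cell L Q x) j))%:E)%E.
  apply: (@le_trans _ _ (\int[lebesgue_measure]_(y in box L)
     (iint L k (fun s => f ((x, y) :: s)) +
      (c * a ^+ k * F (cell L Q x) (cell L Q y))%:E))%E).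
    apply: le_lower_integral => [y _|y _].
      apply: iint_ge0 => s; rewrite adde_ge0// lee_fin mulr_ge0//; exact: prodF_ge0.
    have := IH (c * F (cell L Q x) (cell L Q y)) (fun s => f ((x, y) :: s))
       (mulr_ge0 c0 (F0 _ _)) (fun s => f0 _).
    rewrite -/a [in leRHS]mulrAC; apply: le_trans; apply: le_iint => [s|s _].
      rewrite adde_ge0// lee_fin mulr_ge0//; exact: prodF_ge0.
    by rewrite /prodF big_cons /= mulrA.
  apply: le_trans (@box_integralD_le L _ _ _ _ _) _.
  - by move=> y _; exact: iint_ge0.
  - by move=> y _; rewrite mulr_ge0.
  - exact: (@measurable_comp_cell L Q (fun j => c * a ^+ k * F (cell L Q x) j)).
  rewrite leeD2l// (integral_comp_cell (psi := fun j => c * a ^+ k * F (cell L Q x) j))//.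
    rewrite -mulr_sumr lee_fin le_eqVlt; apply/orP; left; apply/eqP; ring.
  by move=> j; rewrite mulr_ge0.
apply: (@le_trans _ _ (\int[lebesgue_measure]_(x in box L)
   (\int[lebesgue_measure]_(y in box L) iint L k (fun s => f ((x, y) :: s)) +
   (c * a ^+ k * (L / Q%:R * \sum_(j < Q) F (cell L Q x) j))%:E))%E).
  apply: le_lower_integral => [x _|x _]; last exact: inner.
  apply: integral_ge0 => y _; apply: iint_ge0 => s.
  by rewrite adde_ge0// lee_fin mulr_ge0// prodF_ge0.
have h0 : 0 <= L / Q%:R by rewrite divr_ge0 ?ler0n ?ltW.
apply: le_trans (@box_integralD_le L _ _ _ _ _) _.
- by move=> x _; apply: integral_ge0 => y _; exact: iint_ge0.
- by move=> x _; rewrite mulr_ge0// mulr_ge0// sumr_ge0.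
- exact: (@measurable_comp_cell L Q
     (fun i => c * a ^+ k * (L / Q%:R * \sum_(j < Q) F i j))).
rewrite leeD2l//.
rewrite (integral_comp_cell (psi := fun i => c * a ^+ k * (L / Q%:R * \sum_(j < Q) F i j)))//; last first.
  by move=> i; rewrite mulr_ge0// mulr_ge0// sumr_ge0.
rewrite lee_fin -!mulr_sumr -/(sumF Q F) exprS; set b := a ^+ k.
by rewrite /a le_eqVlt; apply/orP; left; apply/eqP; ring.
Qed.

(** For the indicator of an event this is [ppp_prob]; in general it is an expectation in the sense
    of lower integrals. *)
Definition ppp_exp (n : nat) (f : seq (R * R) -> \bar R) : \bar R :=
  (\sum_(k <oo) ((poisson_pmf (n%:R : R) k) * (n%:R ^- k))%:E * iint (side R n) k f)%E.

Let coeff_ge0 (n k : nat) : 0 <= poisson_pmf (n%:R : R) k * n%:R ^- k.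
Proof. by rewrite mulr_ge0 ?poisson_pmf_ge0// invr_ge0 exprn_ge0. Qed.

Lemma le_ppp_exp n (f g : seq (R * R) -> \bar R) :
  (forall s, (0 <= f s)%E) ->
  (forall s, in_box (side R n) s -> (f s <= g s)%E) ->
  (ppp_exp n f <= ppp_exp n g)%E.
Proof.
move=> f0 fg; apply: lee_nneseries => k; first by move=> _ _; rewrite mule_ge0 ?lee_fin ?iint_ge0.
by move=> _; apply: lee_wpmul2l; [rewrite lee_fin|exact: le_iint].
Qed.

Lemma side_gt0 n : (0 < n)%N -> 0 < side R n.
Proof. by move=> n0; rewrite /side sqrtr_gt0 ltr0n. Qed.

Lemma side_sqr n : side R n ^+ 2 = n%:R.
Proof. by rewrite /side sqr_sqrtr ?ler0n. Qed.

(** The powers of [n] cancel, which leaves [exp (- n)] times the exponential series at [a]. *)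
Lemma poisson_series (n : nat) (a : R) : (0 < n)%N -> 0 <= a ->
  (\sum_(k <oo) ((poisson_pmf (n%:R : R) k) * (n%:R ^- k) * a ^+ k)%:E =
   (expR (a - n%:R))%:E)%E.
Proof.
move=> n0 a0; have n0' : (0 : R) < n%:R by rewrite ltr0n.
under eq_eseriesr => k _.
  have -> : poisson_pmf (n%:R : R) k * n%:R ^- k * a ^+ k =
     expR (- n%:R) * (a ^+ k * k`!%:R^-1).
    rewrite /poisson_pmf n0'; set x := expR _.
    have : (n%:R : R) ^+ k != 0 by rewrite expf_neq0// gt_eqF.
    have : (k`!%:R : R) != 0 by rewrite pnatr_eq0 -lt0n fact_gt0.
    by move=> h1 h2; field; rewrite h1 h2.
  rewrite EFinM; over.
rewrite /= nneseriesZl/=; last first.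
  by move=> k _; rewrite lee_fin divr_ge0// exprn_ge0.
rewrite addrC expRD EFinM.
congr *%E; rewrite expRE -EFin_lim; last first.
  rewrite /pseries/=; under eq_fun do rewrite mulrC.
  exact: is_cvg_series_exp_coeff.
apply/congr_lim/funext => m/=; rewrite /pseries/= /series/= -sumEFin//.
by under eq_bigr do rewrite mulrC.
Qed.

(** There are [Q ^ 2] cells of area [n / Q ^ 2], so the exponential equals
    [exp ((n / Q ^ 2) * \sum_c (F c - 1))], the Laplace functional of the process. *)
Lemma ppp_exp_addM_le n Q F (c : R) (f : seq (R * R) -> \bar R) :
  (0 < n)%N -> (0 < Q)%N -> (forall i j, 0 <= F i j) -> 0 <= c ->
  (forall s, (0 <= f s)%E) ->
  (ppp_exp n (fun s => f s + (c * prodF (side R n) Q F s)%:E) <=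
   ppp_exp n f + (c * expR (n%:R / Q%:R ^+ 2 * sumF Q F - n%:R))%:E)%E.
Proof.
move=> n0 Q0 F0 c0 f0; have L0 := side_gt0 n0.
set a := n%:R / Q%:R ^+ 2 * sumF Q F.
have aE : a = (side R n / Q%:R) ^+ 2 * sumF Q F by rewrite expr_div_n side_sqr.
have a0 : 0 <= a.
  by rewrite aE mulr_ge0 ?exprn_ge0 ?divr_ge0 ?ler0n ?(ltW L0)// !sumr_ge0// => *; exact: sumr_ge0.
rewrite EFinM -(poisson_series n0 a0) -nneseriesZl; last first.
  by move=> k _; rewrite lee_fin mulr_ge0// exprn_ge0.
rewrite -nneseriesD; last 2 first.
- by move=> k _ _; rewrite mule_ge0 ?lee_fin ?iint_ge0.
- by move=> k _ _; rewrite mule_ge0 ?lee_fin// mulr_ge0// exprn_ge0.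
apply: lee_nneseries => k.
  move=> _ _; rewrite mule_ge0 ?lee_fin ?iint_ge0// => s.
  by rewrite adde_ge0// lee_fin mulr_ge0// prodF_ge0.
move=> _; apply: (@le_trans _ _ ((poisson_pmf (n%:R : R) k * n%:R ^- k)%:E *
   (iint (side R n) k f + (c * a ^+ k)%:E))%E).
  by rewrite aE; apply: lee_wpmul2l; [rewrite lee_fin|exact: iint_addM_le].
rewrite ge0_muleDr ?iint_ge0 ?lee_fin ?mulr_ge0 ?exprn_ge0//.
by rewrite leeD2l// -!EFinM lee_fin mulrCA.
Qed.

Lemma ppp_exp_add_sum_le n (I : Type) (r : seq I) Q (F : I -> nat -> nat -> R)
    (c : I -> R) (f : seq (R * R) -> \bar R) :
  (0 < n)%N -> (0 < Q)%N -> (forall t i j, 0 <= F t i j) ->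
  (forall t, 0 <= c t) -> (forall s, (0 <= f s)%E) ->
  (ppp_exp n (fun s => f s + (\sum_(t <- r) c t * prodF (side R n) Q (F t) s)%:E) <=
   ppp_exp n f +
   (\sum_(t <- r) c t * expR (n%:R / Q%:R ^+ 2 * sumF Q (F t) - n%:R))%:E)%E.
Proof.
move=> n0 Q0 F0 c0; elim: r f => [|t r IH] f f0.
  rewrite big_nil adde0; apply: le_ppp_exp => s; last by rewrite big_nil adde0.
  by rewrite big_nil adde0.
pose g s := (f s + (c t * prodF (side R n) Q (F t) s)%:E)%E.
have g0 s : (0 <= g s)%E by rewrite adde_ge0// lee_fin mulr_ge0// prodF_ge0.
apply: (@le_trans _ _ (ppp_exp n (fun s => g s +
    (\sum_(t <- r) c t * prodF (side R n) Q (F t) s)%:E))%E).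
  apply: le_ppp_exp => s; last by rewrite /g big_cons EFinD addeA.
  by rewrite adde_ge0// lee_fin sumr_ge0// => t' _; rewrite mulr_ge0// prodF_ge0.
apply: le_trans (IH _ g0) _; rewrite big_cons EFinD addeA leeD2r//.
exact: ppp_exp_addM_le.
Qed.

Lemma ppp_probE n E : @ppp_prob R n E = ppp_exp n (fun s => (`[< E s >])%:R%:E).
Proof. by []. Qed.

Lemma ppp_exp1_le n : (0 < n)%N -> (ppp_exp n (fun=> 1) <= 1)%E.
Proof.
(* With one cell and [F = 1] the product functional is the constant [1], and its expectation is at
   most [exp 0]. *)
move=> n0; apply: (@le_trans _ _ (ppp_exp n (fun s => 0 +
    (1 * prodF (side R n) 1 (fun _ _ => 1) s)%:E))%E).
  apply: le_ppp_exp => // s _; rewrite add0e mul1r /prodF big1_seq//.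
apply: le_trans (ppp_exp_addM_le (f := fun=> 0%E) n0 _ _ _ _) _ => //.
rewrite /sumF big_ord1 big_ord1 expr1n divr1 mulr1 subrr expR0 mulr1.
rewrite -[leRHS]add0e leeD2r// /ppp_exp.
rewrite eseries0// => k _ _.
suff -> : iint (side R n) k (fun=> 0%E) = 0%E by rewrite mule0.
elim: k => [|k IH] //=; apply: integral0_eq => x _.
by apply: integral0_eq => y _; exact: IH.
Qed.

Lemma ppp_prob_le1 n E : (0 < n)%N -> (@ppp_prob R n E <= 1)%E.
Proof.
move=> n0; apply: le_trans (ppp_exp1_le n0); rewrite ppp_probE.
by apply: le_ppp_exp => s; rewrite lee_fin// => _; case: (`[< _ >]).
Qed.

(* Union bound in the only form needed: the exceptional event is dominated by
   a sum of product functionals, whose expectations are explicit; [G] and [E]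
   need not be measurable. *)
Lemma ppp_prob_union_bound n (I : Type) (r : seq I) Q (F : I -> nat -> nat -> R)
    (c : I -> R) (G E : seq (R * R) -> Prop) :
  (0 < n)%N -> (0 < Q)%N -> (forall t i j, 0 <= F t i j) ->
  (forall t, 0 <= c t) ->
  (forall s, in_box (side R n) s -> G s -> ~ E s ->
     1 <= \sum_(t <- r) c t * prodF (side R n) Q (F t) s) ->
  (ppp_prob n G <= ppp_prob n E +
   (\sum_(t <- r) c t * expR (n%:R / Q%:R ^+ 2 * sumF Q (F t) - n%:R))%:E)%E.
Proof.
move=> n0 Q0 F0 c0 H; rewrite !ppp_probE.
apply: le_trans (ppp_exp_add_sum_le _ (f := fun s => (`[< E s >])%:R%:E)
   n0 Q0 F0 c0 _); last by move=> s; rewrite lee_fin.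
apply: le_ppp_exp => s; first by rewrite lee_fin.
move=> bs; have S0 : 0 <= \sum_(t <- r) c t * prodF (side R n) Q (F t) s.
  by apply: sumr_ge0 => t _; rewrite mulr_ge0// prodF_ge0.
rewrite -EFinD lee_fin; case: (asboolP (G s)) => [Gs|_]; last by rewrite addr_ge0.
case: (asboolP (E s)) => [_|nE]; first by rewrite lerDl.
by rewrite add0r; exact: H.
Qed.

End ProductFunctionals.

(** * Renormalization on the square lattice *)

Section Renormalization.
Implicit Types (z u v U : int * int) (d : int).

Definition close d (a c : int) : Prop := a - c <= d /\ c - a <= d.
Definition close2 d u v := close d u.1 v.1 /\ close d u.2 v.2.

(** Adjacency through a side, or equality: the relation is reflexive, which serves for paths of
    length [0]. *)
Definition side_adj u v :=
  (u.1 = v.1 /\ close 1 u.2 v.2) \/ (close 1 u.1 v.1 /\ u.2 = v.2).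

Lemma divz_bounds (a d : int) : 0 < d ->
  d * (a %/ d)%Z <= a < d * (a %/ d)%Z + d.
Proof.
move=> d0; have d1 : d != 0 by lia.
have := divz_eq a d; have := ltz_pmod a d0; have := modz_ge0 a d1; lia.
Qed.

Lemma divz_uniq (a d x : int) : 0 < d -> d * x <= a < d * x + d ->
  (a %/ d)%Z = x.
Proof.
move=> d0 h; have := divz_bounds a d0; set q := (a %/ d)%Z => h'.
have h1 : d * x < d * (q + 1) by lia.
have h2 : d * q < d * (x + 1) by lia.
by move: h1 h2; rewrite !ltr_pM2l//; lia.
Qed.

(** * Connectivity of a rectangle outside a window *)

Section RectanglePaths.
Variables (Rc : int * int -> int * int -> Prop) (Ix Iy : int -> Prop).
Variables (x0 x1 y0 y1 : int).
Hypothesis Rc_sym : forall u v, Rc u v -> Rc v u.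
Hypothesis Rc_trans : forall u v w, Rc u v -> Rc v w -> Rc u w.
Let rect u := (x0 <= u.1 < x1) && (y0 <= u.2 < y1).
Hypothesis Rc_adj : forall u v, rect u -> rect v -> side_adj u v ->
  ~ (Ix u.1 /\ Iy u.2) -> ~ (Ix v.1 /\ Iy v.2) -> Rc u v.

Let row_walk y x (m : nat) : ~ Iy y -> rect (x, y) -> rect (x + m%:Z, y) ->
  Rc (x, y) (x + m%:Z, y).
Proof.
move=> ny; elim: m => [|m IH] rx rm.
  by rewrite addr0; apply: Rc_adj => //=; [left; split; rewrite /close/=; lia|tauto|tauto].
have rm' : rect (x + m%:Z, y) by move: rx rm; rewrite /rect /=; lia.
apply: Rc_trans (IH rx rm') _.
by apply: Rc_adj => //=; [right; split; rewrite /close/=; lia|tauto|tauto].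
Qed.

Let col_walk x y (m : nat) : ~ Ix x -> rect (x, y) -> rect (x, y + m%:Z) ->
  Rc (x, y) (x, y + m%:Z).
Proof.
move=> nx; elim: m => [|m IH] ry rm.
  by rewrite addr0; apply: Rc_adj => //=; [left; split; rewrite /close/=; lia|tauto|tauto].
have rm' : rect (x, y + m%:Z) by move: ry rm; rewrite /rect /=; lia.
apply: Rc_trans (IH ry rm') _.
by apply: Rc_adj => //=; [left; split; rewrite /close/=; lia|tauto|tauto].
Qed.

Let row y x x' : ~ Iy y -> rect (x, y) -> rect (x', y) -> Rc (x, y) (x', y).
Proof.
wlog le : x x' / x <= x'.
  move=> H ny r r'; case: (lerP x x') => [|/ltW] h; first exact: H.
  by apply: Rc_sym; exact: H.
move=> ny r; have -> : x' = x + `|x' - x|%N%:Z by lia.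
exact: row_walk.
Qed.

Let col x y y' : ~ Ix x -> rect (x, y) -> rect (x, y') -> Rc (x, y) (x, y').
Proof.
wlog le : y y' / y <= y'.
  move=> H nx r r'; case: (lerP y y') => [|/ltW] h; first exact: H.
  by apply: Rc_sym; exact: H.
move=> nx r; have -> : y' = y + `|y' - y|%N%:Z by lia.
exact: col_walk.
Qed.

(* A point outside the window [Ix x Iy] has its whole row or its whole column
   outside of it. *)
Lemma rect_connected u v :
  (exists2 x, x0 <= x < x1 & ~ Ix x) -> (exists2 y, y0 <= y < y1 & ~ Iy y) ->
  rect u -> rect v -> ~ (Ix u.1 /\ Iy u.2) -> ~ (Ix v.1 /\ Iy v.2) -> Rc u v.
Proof.
case=> xs xsr nxs [ys ysr nys].
have to_hub w : rect w -> ~ (Ix w.1 /\ Iy w.2) -> Rc w (xs, ys).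
  case: w => x y rw nw; have [ix|nx] := pselect (Ix x).
    have ny : ~ Iy y by move=> iy; apply: nw.
    apply: (@Rc_trans _ (xs, y)); [apply: row|apply: col] => //;
    by move: rw; rewrite /rect /=; lia.
  apply: (@Rc_trans _ (x, ys)); [apply: col|apply: row] => //;
  by move: rw; rewrite /rect /=; lia.
by move=> ru rv nu nv; apply: Rc_trans (to_hub _ ru nu) _; exact/Rc_sym/to_hub.
Qed.

End RectanglePaths.

(** * Bad boxes, clean boxes and cores at all levels of the hierarchy *)

Variables (V : Type) (conn : V -> V -> Prop) (blk : V -> int * int -> Prop).
Variables (bad0 : int * int -> Prop) (b : nat -> int).
Hypothesis conn_sym : forall x y, conn x y -> conn y x.
Hypothesis conn_trans : forall x y w, conn x y -> conn y w -> conn x w.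
Hypothesis blk_nonempty : forall z, ~ bad0 z -> exists x, blk x z.
Hypothesis blk_conn : forall z z' x x', ~ bad0 z -> ~ bad0 z' ->
  side_adj z z' -> blk x z -> blk x' z' -> conn x x'.
Hypothesis b_ge : forall j, 20 <= b j.

(** [U] is a box of side [d] in units of the next finer level; [in3] describes its [3 x 3]
    neighbourhood, and [child] the box itself. *)
Definition in3 d u U := (d * (U.1 - 1) <= u.1 < d * (U.1 + 2)) &&
  (d * (U.2 - 1) <= u.2 < d * (U.2 + 2)).
Definition child d u U := (d * U.1 <= u.1 < d * U.1 + d) &&
  (d * U.2 <= u.2 < d * U.2 + d).

(** The distance [4] is twice the radius [2] within which the witnesses of a bad box stay, so the
    witnesses of [u] and [v] are disjoint. *)
Fixpoint bad j U : Prop :=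
  if j is j'.+1 then exists u v, [/\ in3 (b j') u U, in3 (b j') v U,
     bad j' u, bad j' v & ~ close2 4 u v]
  else bad0 U.

Definition clean j u := forall v, close2 4 v u -> ~ bad j v.

(** The blocks reached from [U] by descending through clean children only; cleanness keeps each step
    outside the window of bad boxes. *)
Fixpoint core j U z : Prop :=
  if j is j'.+1 then exists u, [/\ child (b j') u U, clean j' u & core j' u z]
  else z = U.

Fixpoint anc j z : int * int :=
  if j is j'.+1 then (((anc j' z).1 %/ b j')%Z, ((anc j' z).2 %/ b j')%Z) else z.

Lemma clean_not_bad j u : clean j u -> ~ bad j u.
Proof. by apply; rewrite /close2 /close; lia. Qed.

Lemma child_divP d u U : 0 < d ->
  child d u U <-> U = ((u.1 %/ d)%Z, (u.2 %/ d)%Z).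
Proof.
case: U => x y d0; rewrite /child /=; split.
  by case/andP => h1 h2; rewrite -(divz_uniq d0 h1) -(divz_uniq d0 h2).
by case=> -> ->; rewrite !divz_bounds.
Qed.

Lemma core_not_bad0 j U z : ~ bad j U -> core j U z -> ~ bad0 z.
Proof.
elim: j U => [|j IH] U nb /=; first by move->.
by case=> u [_ cu cz]; exact: IH (clean_not_bad cu) cz.
Qed.

Lemma b_gt0 j : 0 < b j. Proof. by have := b_ge j; lia. Qed.

Lemma core_anc j U z : core j U z -> anc j z = U.
Proof.
elim: j U => [|j IH] U //= [u [cu _ /IH ->]].
by apply/esym/child_divP => //; exact: b_gt0.
Qed.

(** The clauses [~ bad0] here, and the existence clauses in [core_linked], supply the intermediate
    point that makes these relations transitive. *)
Definition linked z z' := [/\ ~ bad0 z, ~ bad0 z' &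
  forall x x', blk x z -> blk x' z' -> conn x x'].

Lemma linked_sym z z' : linked z z' -> linked z' z.
Proof. by case=> h1 h2 h; split=> // x x' bx bx'; apply/conn_sym/h. Qed.

Lemma linked_trans z z' z'' : linked z z' -> linked z' z'' -> linked z z''.
Proof.
case=> h1 h2 h [h3 h4 h']; split=> // x x' bx bx'.
by have [y By] := blk_nonempty h2; apply: conn_trans (h _ _ bx By) (h' _ _ By bx').
Qed.

Definition core_linked j u v := [/\ exists z, core j u z, exists z, core j v z &
  forall z z', core j u z -> core j v z' -> linked z z'].

Lemma core_linked_sym j u v : core_linked j u v -> core_linked j v u.
Proof. by case=> h1 h2 h; split=> // z z' cz cz'; apply/linked_sym/h. Qed.

Lemma core_linked_trans j u v w :
  core_linked j u v -> core_linked j v w -> core_linked j u w.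
Proof.
case=> h1 [y cy] h [_ h4 h']; split=> // z z' cz cz'.
exact: linked_trans (h _ _ cz cy) (h' _ _ cy cz').
Qed.

(** If [v] is bad in the neighbourhood of [U], all bad sub-boxes there are within [4] of [v]. This
    window has [9] columns and [9] rows, so ten consecutive ones contain a free one. A clean box
    lies outside it because [v] is bad. *)
Lemma bad_window j U : ~ bad j.+1 U -> exists Ix Iy : int -> Prop,
  [/\ forall u, in3 (b j) u U -> bad j u -> Ix u.1 /\ Iy u.2,
      forall u, clean j u -> ~ (Ix u.1 /\ Iy u.2),
      forall x, exists2 x', x <= x' < x + 9 + 1 & ~ Ix x' &
      forall y, exists2 y', y <= y' < y + 9 + 1 & ~ Iy y'].
Proof.
move=> nb; have [[v [vU bv]]|no] := pselect (exists v, in3 (b j) v U /\ bad j v).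
  exists (fun x => close 4 x v.1), (fun y => close 4 y v.2).
  have free a c : exists2 x, a <= x < a + 9 + 1 & ~ close 4 x c.
    have [h|h] := pselect (close 4 a c); last by exists a => //; lia.
    by exists (a + 9); [lia|move: h; rewrite /close; lia].
  split=> // [u uU bu|u cu [h1 h2]].
    have [h|h] := pselect (close2 4 u v); first exact: h.
    by case: nb; exists u, v.
  by apply: (cu v) bv; move: h1 h2; rewrite /close2 /close; lia.
exists (fun=> False), (fun=> False); split=> //.
- by move=> u uU bu; case: no; exists u.
- by move=> u _ [].
- by move=> x; exists x => //; lia.
- by move=> x; exists x => //; lia.
Qed.

(** A rectangle of sides at least [b j >= 20] has a row and a column free of the window, and its
    boxes outside the window are not bad, so adjacent ones are linked by the first hypothesis. *)
Lemma core_linked_in_window j U x0 x1 y0 y1 (Ix Iy : int -> Prop) u v :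
  (forall u v, ~ bad j u -> ~ bad j v -> side_adj u v -> core_linked j u v) ->
  (forall u, in3 (b j) u U -> bad j u -> Ix u.1 /\ Iy u.2) ->
  (forall x, exists2 x', x <= x' < x + 9 + 1 & ~ Ix x') ->
  (forall y, exists2 y', y <= y' < y + 9 + 1 & ~ Iy y') ->
  x0 + b j <= x1 -> y0 + b j <= y1 ->
  b j * (U.1 - 1) <= x0 -> x1 <= b j * (U.1 + 2) ->
  b j * (U.2 - 1) <= y0 -> y1 <= b j * (U.2 + 2) ->
  (x0 <= u.1 < x1) && (y0 <= u.2 < y1) -> (x0 <= v.1 < x1) && (y0 <= v.2 < y1) ->
  ~ (Ix u.1 /\ Iy u.2) -> ~ (Ix v.1 /\ Iy v.2) -> core_linked j u v.
Proof.
move=> IH W Wx Wy hx hy bx0 bx1 by0 by1.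
have bj := b_ge j.
apply: (rect_connected (@core_linked_sym j) (@core_linked_trans j)).
- move=> u' v' ru rv adj nu nv; apply: IH => //.
    move=> bu; apply: nu; apply: W bu.
    by move: ru; rewrite /in3; lia.
  move=> bv; apply: nv; apply: W bv.
  by move: rv; rewrite /in3; lia.
- by have [x xr nx] := Wx x0; exists x => //; lia.
- by have [y yr ny] := Wy y0; exists y => //; lia.
Qed.

(** A bad box within [4] of a child of [U] lies in the neighbourhood of [U], hence within [4] of any
    fixed bad box [v] there; unclean children are thus within [4 + 4] of [v]. *)
Lemma unclean_close j U : ~ bad j.+1 U ->
  exists v, forall u, child (b j) u U -> ~ close2 8 u v -> clean j u.
Proof.
move=> nb; have bj := b_ge j.
have in3U u w : child (b j) u U -> close2 4 w u -> in3 (b j) w U.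
  by rewrite /child /close2 /close /in3; lia.
have [[v [vU bv]]|no] := pselect (exists v, in3 (b j) v U /\ bad j v).
  exists v => u cu nuv w wu bw; have wU := in3U _ _ cu wu.
  have [h|h] := pselect (close2 4 w v); last by case: nb; exists w, v.
  by apply: nuv; move: wu h; rewrite /close2 /close; lia.
exists (0, 0) => u cu _ w wu bw; case: no; exists w; split=> //.
exact: in3U cu wu.
Qed.

Lemma exists_clean_child j U : ~ bad j.+1 U -> exists2 u, child (b j) u U & clean j u.
Proof.
move=> /unclean_close[v H]; have bj := b_ge j.
have [h|h] := pselect (close 8 (b j * U.1) v.1).
  (* A shift by [17 = 2 * 8 + 1] leaves the interval of radius [8], and stays in [U] because
     [b j >= 20]. *)
  exists (b j * U.1 + 17, b j * U.2); first by rewrite /child /=; lia.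
  by apply: H; [rewrite /child /=; lia|move: h; rewrite /close2 /close /=; lia].
exists (b j * U.1, b j * U.2); first by rewrite /child /=; lia.
by apply: H; [rewrite /child /=; lia|move: h; rewrite /close2 /close /=; lia].
Qed.

(** The children of both boxes fill a rectangle in the neighbourhood of the first, and the clean
    ones avoid its window; by induction the cores of the sub-boxes outside the window are linked. *)
Lemma core_linked_adj j u v : ~ bad j u -> ~ bad j v -> side_adj u v ->
  core_linked j u v.
Proof.
elim: j u v => [|j IH] U V' nU nV adj.
  split=> /=; [by exists U|by exists V'|move=> z z' -> ->].
  by split=> // x x' bx bx'; exact: blk_conn adj bx bx'.
have core_ex W : ~ bad j.+1 W -> exists z, core j.+1 W z.
  move=> /exists_clean_child[u cu clu]; have nu := clean_not_bad clu.
  have [|[z cz] _ _] := IH u u nu nu; first by rewrite /side_adj /close; lia.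
  by exists z, u.
split; [exact: core_ex|exact: core_ex|].
move=> z z' [u [cu clu cz]] [v [cv clv cz']].
have [Ix [Iy [W Wc Wx Wy]]] := bad_window nU.
have bj := b_ge j.
have [||||||||||_ _ /(_ _ _ cz cz') //] := @core_linked_in_window j U
  (Num.min (b j * U.1) (b j * V'.1)) (Num.max (b j * U.1 + b j) (b j * V'.1 + b j))
  (Num.min (b j * U.2) (b j * V'.2)) (Num.max (b j * U.2 + b j) (b j * V'.2 + b j))
  Ix Iy u v IH W Wx Wy; try exact: Wc; try by move: cu cv; rewrite /child; lia.
all: by case: adj; rewrite /close; nia.
Qed.

Lemma uniq_flatten_map (I T : eqType) (f : I -> seq T) (L : seq I) :
  uniq L -> (forall i, i \in L -> uniq (f i)) ->
  (forall i i' x, i \in L -> i' \in L -> x \in f i -> x \in f i' -> i = i') ->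
  uniq (flatten (map f L)).
Proof.
elim: L => [|a L IH] //= /andP[aL uL] uf disj; rewrite cat_uniq uf ?mem_head//=.
rewrite IH// => [|i iL|i i' x iL iL']; first last.
- by apply: disj; rewrite inE ?iL ?iL' orbT.
- by apply: uf; rewrite inE iL orbT.
rewrite andbT; apply/hasPn => x /flatten_mapP[i iL xi]; apply/negP => xa.
have e := disj a i x; rewrite e ?mem_head ?inE ?iL ?orbT// in aL.
Qed.

Definition square (x y : int) (m : nat) : seq (int * int) :=
  [seq (x + i%:Z, y + j%:Z) | i <- iota 0 m, j <- iota 0 m].

Lemma mem_square x y m u :
  (u \in square x y m) = (x <= u.1 < x + m%:Z) && (y <= u.2 < y + m%:Z).
Proof.
apply/allpairsP/idP => [[[i j] /= [hi hj ->]]|h] /=.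
  by move: hi hj; rewrite !mem_iota; lia.
exists (`|u.1 - x|%N, `|u.2 - y|%N) => /=; rewrite !mem_iota; split; try lia.
by case: u h => a c /= h; congr pair; lia.
Qed.

Lemma square_uniq x y m : uniq (square x y m).
Proof.
apply: allpairs_uniq; rewrite ?iota_uniq// => -[i j] [i' j'] _ _ /= [].
by move=> h1 h2; congr pair; lia.
Qed.

Lemma size_square x y m : size (square x y m) = (m * m)%N.
Proof. by rewrite size_allpairs size_iota. Qed.

(** At most [17 * 17] children of a good box are unclean, since these are within [8] of a single
    box. *)
Fixpoint core_density j : nat :=
  if j is j'.+1 then ((`|b j'| * `|b j'| - 17 * 17) * core_density j')%N else 1%N.

Lemma core_count j U : ~ bad j U -> exists s : seq (int * int),
  [/\ uniq s, forall z, z \in s -> core j U z & (core_density j <= size s)%N].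
Proof.
elim: j U => [|j IH] U nb.
  by exists [:: U]; split=> //= z; rewrite inE => /eqP.
have [v H] := unclean_close nb; have bj := b_ge j.
pose S := square (b j * U.1) (b j * U.2) `|b j|%N.
pose N := square (v.1 - 8) (v.2 - 8) 17.
pose L := [seq u <- S | u \notin N].
have LP u : u \in L -> child (b j) u U /\ clean j u.
  rewrite mem_filter /S /N !mem_square => /andP[nN uS].
  have cu : child (b j) u U by move: uS; rewrite /child; lia.
  by split=> //; apply: H => //; move: nN; rewrite /close2 /close; lia.
have sL : (`|b j| * `|b j| - 17 * 17 <= size L)%N.
  rewrite size_filter -(size_square (b j * U.1) (b j * U.2)) -/S.
  rewrite -(size_square (v.1 - 8) (v.2 - 8) 17) -/N.
  rewrite leq_subLR -(count_predC (mem N) S) leq_add2r -size_filter.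
  apply: uniq_leq_size; first by rewrite filter_uniq// square_uniq.
  by move=> u; rewrite mem_filter => /andP[].
have /choice[f fP] : forall u, exists s : seq (int * int), u \in L ->
   [/\ uniq s, forall z, z \in s -> core j u z & (core_density j <= size s)%N].
  move=> u; have [uL|nL] := pselect (u \in L); last by exists [::].
  have [_ /clean_not_bad/IH[s sP]] := LP _ uL; by exists s.
exists (flatten (map f L)); split.
- apply: uniq_flatten_map; first by rewrite filter_uniq// square_uniq.
    by move=> u /fP[].
  (* A block determines its ancestor of level [j], so the cores of distinct children are
     disjoint. *)
  move=> u u' z uL uL' zu zu'; have [_ h _] := fP _ uL; have [_ h' _] := fP _ uL'.
  by rewrite -(core_anc (h _ zu)) -(core_anc (h' _ zu')).
- move=> z /flatten_mapP[u uL zu]; have [cu clu] := LP _ uL.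
  by have [_ h _] := fP _ uL; exists u; split=> //; exact: h.
- apply: (@leq_trans (size L * core_density j)); first by rewrite /= leq_mul2r sL orbT.
  rewrite size_flatten /shape -map_comp.
  have : forall u, u \in L -> (core_density j <= size (f u))%N by move=> u /fP[].
  elim: L {LP sL fP} => [|a L IHL] h //=; rewrite mulSn leq_add ?h ?mem_head//.
  by apply: IHL => u uL; apply: h; rewrite inE uL orbT.
Qed.

Lemma divz_close1 (a c d : int) : 0 < d -> close 1 a c ->
  close 1 (a %/ d)%Z (c %/ d)%Z.
Proof.
move=> d0 h; have := divz_bounds a d0; have := divz_bounds c d0.
set p := (a %/ d)%Z; set q := (c %/ d)%Z => hq hp.
have h1 : d * q < d * (p + 2) by move: h; rewrite /close; lia.
have h2 : d * p < d * (q + 2) by move: h; rewrite /close; lia.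
by move: h1 h2; rewrite !ltr_pM2l// /close; lia.
Qed.

Lemma anc_close1 j z z' : close2 1 z z' -> close2 1 (anc j z) (anc j z').
Proof.
by elim: j => [|j IH] //= /IH[h1 h2]; split; apply: divz_close1 => //; exact: b_gt0.
Qed.

Lemma discrete_IVT (f : nat -> int) (T : nat) (x : int) :
  (forall t, (t < T)%N -> close 1 (f t) (f t.+1)) ->
  (f 0%N <= x <= f T) || (f T <= x <= f 0%N) ->
  exists2 t, (t <= T)%N & f t = x.
Proof.
elim: T => [|T IH] st h; first by exists 0%N => //; lia.
have [e|ne] := eqVneq (f T.+1) x; first by exists T.+1.
have [|t tT ft] := IH (fun t tT => st t (ltnW tT)); last by exists t => //; exact: leqW.
by move: h ne (st T (ltnSn T)); rewrite /close; lia.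
Qed.

(** In the application this is a path of the torus lifted to the plane: a vertex lies in all
    translates of its block, and consecutive blocks are chosen at sup distance at most [1]. *)
Definition lifted_path (g : nat -> V * (int * int)) T :=
  (forall t, (t <= T)%N -> blk (g t).1 (g t).2) /\
  (forall t, (t < T)%N -> close2 1 (g t).2 (g t.+1).2 /\ conn (g t).1 (g t.+1).1).

Lemma lifted_path_conn g T t : (forall x, conn x x) -> lifted_path g T ->
  (t <= T)%N -> conn (g 0%N).1 (g t).1.
Proof.
move=> conn_refl [_ st]; elim: t => [|t IH] tT; first exact: conn_refl.
by apply: conn_trans (IH (ltnW tT)) _; have [] := st t tT.
Qed.

Lemma lifted_path_rev g T t : lifted_path g T -> (t <= T)%N ->
  lifted_path (fun s => g (t - s)%N) t.
Proof.
move=> [bg st] tT; split=> s st'; first by apply: bg; lia.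
have e : (t - s = (t - s.+1).+1)%N by lia.
have [h1 h2] := st (t - s.+1)%N ltac:(lia); rewrite e; split; last exact: conn_sym.
by move: h1; rewrite /close2 /close; lia.
Qed.

(* The path must leave the window containing all bad children of [3U] before
   leaving [3U]; at such a time it sits in a good child, out of whose
   neighbourhood it came, and the induction hypothesis applies to the path run
   backwards from there. *)
Lemma escaping_path_meets_core j U g T : (forall x, conn x x) -> ~ bad j U ->
  lifted_path g T -> anc j (g 0%N).2 = U -> ~ close2 1 (anc j (g T).2) U ->
  forall z x, core j U z -> blk x z -> conn (g 0%N).1 x.
Proof.
move=> conn_refl; elim: j U g T => [|j IH] U g T nb pg g0 gT z x cz bx.
  have zU : z = U := cz; rewrite -g0 /= in zU.
  have [bg _] := pg; apply: (@blk_conn z z) => //.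
  - by rewrite zU -[(g 0%N).2]/(anc 0 (g 0%N).2) g0.
  - by rewrite zU -[(g 0%N).2]/(anc 0 (g 0%N).2) g0.
  - by rewrite /side_adj /close; lia.
  - by rewrite zU; apply: bg.
have bj := b_ge j; have bj0 := b_gt0 j.
pose a t := anc j (g t).2.
have ancS t : child (b j) (a t) (anc j.+1 (g t).2) by apply/child_divP.
have ex_exit : exists t, (t <= T)%N && `[< ~ close2 1 (anc j.+1 (g t).2) U >].
  by exists T; rewrite leqnn; exact/asboolP.
(* [T0] is the first time outside the [3 x 3] neighbourhood of [U]. *)
case: (ex_minnP ex_exit) => T0 /andP[T0T /asboolP exT0] minT0.
have before t : (t < T0)%N -> in3 (b j) (a t) U.
  move=> tT0; have nU : close2 1 (anc j.+1 (g t).2) U.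
    apply: contrapT => h; suff : (T0 <= t)%N by lia.
    by apply: minT0; rewrite (leq_trans (ltnW tT0) T0T); exact/asboolP.
  by move: (ancS t) nU; rewrite /child /in3 /close2 /close; nia.
have [Ix [Iy [W Wc Wx Wy]]] := bad_window nb.
have steps t : (t < T0)%N -> close2 1 (a t) (a t.+1).
  move=> tT0; apply: anc_close1; have [_ st] := pg.
  by have [] := st t (leq_trans tT0 T0T).
have c0 := ancS 0%N; rewrite g0 in c0; have cT := ancS T0.
set E := anc j.+1 (g T0).2 in exT0 cT.
have [t tT0 [nW far]] : exists2 t, (t < T0)%N &
    ~ (Ix (a t).1 /\ Iy (a t).2) /\ ~ close2 1 (a 0%N) (a t).
  (* A column free of the window that separates the start from the exit, at distance more than [1]
     from the start, is crossed before time [T0]. *)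
  have go1 x' : ~ Ix x' -> ~ close 1 (a 0%N).1 x' -> x' <> (a T0).1 ->
      ((a 0%N).1 <= x' <= (a T0).1) || ((a T0).1 <= x' <= (a 0%N).1) ->
      exists2 t, (t < T0)%N & ~ (Ix (a t).1 /\ Iy (a t).2) /\ ~ close2 1 (a 0%N) (a t).
    move=> nI nn ne /(@discrete_IVT (fun t => (a t).1))[].
      by move=> t /steps[].
    move=> t; rewrite leq_eqVlt => /predU1P[->|tT0 e]; first by move/esym.
    by exists t => //; rewrite e; split=> [[]//|]; case=> + _; rewrite e.
  have go2 x' : ~ Iy x' -> ~ close 1 (a 0%N).2 x' -> x' <> (a T0).2 ->
      ((a 0%N).2 <= x' <= (a T0).2) || ((a T0).2 <= x' <= (a 0%N).2) ->
      exists2 t, (t < T0)%N & ~ (Ix (a t).1 /\ Iy (a t).2) /\ ~ close2 1 (a 0%N) (a t).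
    move=> nI nn ne /(@discrete_IVT (fun t => (a t).2))[].
      by move=> t /steps[].
    move=> t; rewrite leq_eqVlt => /predU1P[->|tT0 e]; first by move/esym.
    by exists t => //; rewrite e; split=> [[]//|]; case=> _; rewrite e.
  have [h|h1] := pselect (E.1 >= U.1 + 2).
    (* The ten columns from here on are at distance at least [2] from the children of [U] and, as
       [b j >= 20], before column [b j * (U.1 + 2)]. On the other side the ten columns from
       [b j * U.1 - 15] on serve in the same way. *)
    have [x' xr nx] := Wx (b j * U.1 + b j + 1).
    by apply: (go1 x') => //; move: c0 cT h; rewrite /child /close; nia.
  have [h|h2] := pselect (E.1 <= U.1 - 2).
    have [x' xr nx] := Wx (b j * U.1 - 15).
    by apply: (go1 x') => //; move: c0 cT h; rewrite /child /close; nia.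
  have [h|h3] := pselect (E.2 >= U.2 + 2).
    have [x' xr nx] := Wy (b j * U.2 + b j + 1).
    by apply: (go2 x') => //; move: c0 cT h; rewrite /child /close; nia.
  have [h|h4] := pselect (E.2 <= U.2 - 2).
    have [x' xr nx] := Wy (b j * U.2 - 15).
    by apply: (go2 x') => //; move: c0 cT h; rewrite /child /close; nia.
  by exfalso; apply: exT0; rewrite /close2 /close; lia.
have tT : (t <= T)%N := leq_trans (ltnW tT0) T0T.
have tU := before t tT0.
have nbt : ~ bad j (a t) by move=> /(W _ tU).
case: cz => u [cu clu cz].
have [[z' cz'] _ L] : core_linked j (a t) u.
  apply: (@core_linked_in_window j U
    (b j * (U.1 - 1)) (b j * (U.1 + 2)) (b j * (U.2 - 1)) (b j * (U.2 + 2))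
    Ix Iy (a t) u (@core_linked_adj j) W Wx Wy) => //; try exact: Wc;
  by move: cu tU; rewrite /child /in3; lia.
have nz' := core_not_bad0 nbt cz'; have [x' bx'] := blk_nonempty nz'.
apply: conn_trans (lifted_path_conn conn_refl pg tT) _.
have [_ _ Lzz'] := L _ _ cz' cz; apply: conn_trans (Lzz' _ _ bx' bx).
have rp := lifted_path_rev pg tT.
have := IH (a t) _ t nbt rp; rewrite subn0 subnn.
by move=> /(_ erefl far z' x' cz' bx').
Qed.

Lemma core_linked_all j : (forall U, ~ bad j U) -> forall u v, core_linked j u v.
Proof.
move=> nb u v.
apply: (@rect_connected (core_linked j) (fun=> False) (fun=> False)
  (Num.min u.1 v.1) (Num.max u.1 v.1 + 1) (Num.min u.2 v.2) (Num.max u.2 v.2 + 1)).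
- exact: core_linked_sym.
- exact: core_linked_trans.
- by move=> u' v' _ _ adj _ _; exact: core_linked_adj.
- by exists u.1 => //; lia.
- by exists u.2 => //; lia.
- lia.
- lia.
- by case.
- by case.
Qed.

(** [m j] is the period measured in boxes of level [j]; a translation by a period acts on every
    level at once. *)
Lemma bad_periodic (m : nat -> int) (k : nat) :
  (forall z (w1 w2 : int), bad0 (z.1 + m 0%N * w1, z.2 + m 0%N * w2) -> bad0 z) ->
  (forall j, (j < k)%N -> m j = b j * m j.+1) ->
  forall j U (w1 w2 : int), (j <= k)%N ->
  bad j (U.1 + m j * w1, U.2 + m j * w2) -> bad j U.
Proof.
move=> per mE; elim=> [|j IH] U w1 w2 jk; first exact: per.
case=> u [v [uU vU bu bv nuv]].
have e := mE j jk.
exists (u.1 - m j * w1, u.2 - m j * w2), (v.1 - m j * w1, v.2 - m j * w2).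
have e1 : m j * w1 = b j * (m j.+1 * w1) by rewrite e mulrA.
have e2 : m j * w2 = b j * (m j.+1 * w2) by rewrite e mulrA.
split.
- by move: uU; rewrite /in3 /=; rewrite e1 e2; lia.
- by move: vU; rewrite /in3 /=; rewrite e1 e2; lia.
- by apply: (IH _ w1 w2 (ltnW jk)); rewrite /= !subrK -surjective_pairing.
- by apply: (IH _ w1 w2 (ltnW jk)); rewrite /= !subrK -surjective_pairing.
- by move: nuv; rewrite /close2 /close /=; lia.
Qed.

Fixpoint scale j : int := if j is j'.+1 then scale j' * b j' else 1.

Lemma anc_shift j z (w1 w2 : int) :
  anc j (z.1 + scale j * w1, z.2 + scale j * w2) =
  ((anc j z).1 + w1, (anc j z).2 + w2).
Proof.
elim: j w1 w2 => [|j IH] w1 w2 /=; first by rewrite !mul1r.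
rewrite -!mulrA IH /=; have bj := b_gt0 j; congr pair.
  by apply: divz_uniq => //; have := divz_bounds (anc j z).1 bj; lia.
by apply: divz_uniq => //; have := divz_bounds (anc j z).2 bj; lia.
Qed.

(** * Sets of empty cells forced by a bad box *)

Section Witnesses.
Variable empty : int * int -> Prop.
Hypothesis bad0_empty : forall z, bad0 z ->
  exists2 c : int * int, c \in square (6 * z.1) (6 * z.2) 6 & empty c.

Definition block_of (c : int * int) : int * int := ((c.1 %/ 6)%Z, (c.2 %/ 6)%Z).

Definition square3 j U := square (b j * (U.1 - 1)) (b j * (U.2 - 1)) (3 * `|b j|).

Fixpoint witnesses j U : seq (seq (int * int)) :=
  if j is j'.+1 then
    flatten [seq [seq S1 ++ S2 | S1 <- witnesses j' p.1, S2 <- witnesses j' p.2]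
            | p <- [seq p <- [seq (u, v) | u <- square3 j' U, v <- square3 j' U]
                   | ~~ `[< close2 4 p.1 p.2 >]]]
  else [seq [:: c] | c <- square (6 * U.1) (6 * U.2) 6].

(** A block has [36] cells, and the neighbourhood of a box contains [(3 * b j) ^ 4] ordered pairs of
    sub-boxes. *)
Fixpoint witness_count j : nat :=
  if j is j'.+1 then ((3 * `|b j'|) ^ 4 * witness_count j' ^ 2)%N else 36%N.

Lemma size_witnesses j U : (size (witnesses j U) <= witness_count j)%N.
Proof.
elim: j U => [|j IH] U; first by rewrite size_map size_square.
rewrite [witnesses _ _]/=; set L := [seq p <- _ | _].
have sL : (size L <= (3 * `|b j|) ^ 4)%N.
  rewrite size_filter; apply: leq_trans (count_size _ _) _.
  by rewrite size_allpairs size_square; lia.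
apply: (@leq_trans (size L * witness_count j ^ 2)); last by rewrite leq_mul2r sL orbT.
elim: L {sL} => [|p L IHL] //=; rewrite size_cat mulSn leq_add// size_allpairs.
by rewrite expnS expn1 leq_mul.
Qed.

Lemma bad_witness j U : bad j U ->
  exists2 S, S \in witnesses j U & forall c : int * int, c \in S -> empty c.
Proof.
elim: j U => [|j IH] U.
  move=> /bad0_empty[c cs ec]; exists [:: c]; first by apply/mapP; exists c.
  by move=> c'; rewrite inE => /eqP ->.
case=> u [v [uU vU /IH[S1 S1w e1] /IH[S2 S2w e2] nuv]].
exists (S1 ++ S2); last by move=> c; rewrite mem_cat => /orP[/e1|/e2].
apply/flatten_mapP; exists (u, v); last by apply/allpairsP; exists (S1, S2).
rewrite mem_filter; apply/andP; split; first exact/asboolPn.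
have bj := b_gt0 j.
have memU w : in3 (b j) w U -> w \in square3 j U.
  by rewrite /in3 /square3 mem_square; lia.
by apply/allpairsP; exists (u, v); split; rewrite ?memU.
Qed.

(** The radius [2] reproduces itself: a box within [2] of a sub-box of the neighbourhood of [U] has
    its parent within [2] of [U], because [2 < b j]. As [u] and [v] are more than [4] apart, their
    witnesses are disjoint and the sizes add. *)
Lemma witnessP j U S : S \in witnesses j U -> [/\ size S = (2 ^ j)%N, uniq S &
  forall c : int * int, c \in S -> close2 2 (anc j (block_of c)) U].
Proof.
elim: j U S => [|j IH] U S.
  case/mapP => c; rewrite mem_square => cs ->; split=> // c'; rewrite inE => /eqP ->.
  suff -> : block_of c = U by rewrite /close2 /close /=; lia.
  by case: U cs => x y /= cs; congr pair; apply: divz_uniq => //; lia.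
case/flatten_mapP => -[u v]; rewrite mem_filter => /andP[/asboolPn nuv].
case/allpairsP => -[u' v'] /= [uU vU [? ?]]; subst u' v'.
case/allpairsP => -[S1 S2] /= [/IH[s1 u1 n1] /IH[s2 u2 n2] ->].
have bj := b_ge j; have bj0 := b_gt0 j.
have nearU w c : w \in square3 j U -> close2 2 (anc j (block_of c)) w ->
    close2 2 (anc j.+1 (block_of c)) U.
  rewrite /square3 mem_square => wU; set a := anc j _.
  have := divz_bounds a.1 bj0; have := divz_bounds a.2 bj0.
  move: wU; rewrite /close2 /close /=; set p := (a.1 %/ _)%Z; set r := (a.2 %/ _)%Z.
  move=> wU hr hp nw.
  have h1 : b j * p < b j * (U.1 + 3) by lia.
  have h2 : b j * r < b j * (U.2 + 3) by lia.
  have h3 : b j * (U.1 - 3) < b j * p by lia.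
  have h4 : b j * (U.2 - 3) < b j * r by lia.
  by move: h1 h2 h3 h4; rewrite !ltr_pM2l//; lia.
split.
- by rewrite size_cat s1 s2 expnS; lia.
- rewrite cat_uniq u1 u2 andbT; apply/hasPn => c c2; apply/negP => c1.
  by apply: nuv; move: (n1 _ c1) (n2 _ c2); rewrite /close2 /close /=; lia.
- by move=> c; rewrite mem_cat => /orP[/n1|/n2]; exact: nearU.
Qed.

End Witnesses.

End Renormalization.

(** * Cells of the torus *)

Section TorusGeometry.
Variable R : realType.
Implicit Types (L : R) (Q : nat) (x y : R).

(** The difference of integer parts is an integer of absolute value less than [m + 1], hence at most
    [m]. *)
Lemma close_floor (c c' : nat) (w : int) (a a' : R) (m Q : nat) :
  c%:R <= a < c.+1%:R -> c'%:R <= a' < c'.+1%:R ->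
  `|a - a' - w%:~R * Q%:R| <= m%:R -> close m%:Z c%:Z (c'%:Z + w * Q%:Z).
Proof.
move=> /andP[a1 a2] /andP[a3 a4]; rewrite ler_norml => /andP[h1 h2].
have hw : w%:~R * Q%:R = (w * Q%:Z)%:~R :> R by rewrite intrM.
rewrite hw in h1 h2; move: h1 h2 a2 a4.
rewrite -[c.+1]addn1 -[c'.+1]addn1 !natrD => h1 h2 a2 a4.
have e1 : (c%:Z - (c'%:Z + w * Q%:Z))%:~R < (m%:Z + 1)%:~R :> R.
  by rewrite !(intrD, intrN) mulr1z; lra.
have e2 : (c'%:Z + w * Q%:Z - c%:Z)%:~R < (m%:Z + 1)%:~R :> R.
  by rewrite !(intrD, intrN) mulr1z; lra.
by move: e1 e2; rewrite !ltr_int /close; lia.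
Qed.

Lemma box_diff L x y : box L x -> box L y -> - L < x - y < L.
Proof. by rewrite /box /= !in_itv /=; lra. Qed.

(** The value [0], [1] or [-1] of [w] selects the translate of [y] by [w * L] that is near [x]. *)
Lemma cell_close L Q x y (rho : R) (m : nat) : 0 < L -> (0 < Q)%N ->
  box L x -> box L y -> tcoord L (x - y) <= rho -> rho * Q%:R / L <= m%:R ->
  exists w : int, close m%:Z (cell L Q x)%:Z ((cell L Q y)%:Z + w * Q%:Z).
Proof.
move=> L0 Q0 bx By ht hm; have Q0' : 0 < Q%:R :> R by rewrite ltr0n.
have cx := cell_itv L0 Q0 bx; have cy := cell_itv L0 Q0 By.
have dxy := box_diff bx By.
have key (w : int) : `|x - y - w%:~R * L| <= rho ->
    close m%:Z (cell L Q x)%:Z ((cell L Q y)%:Z + w * Q%:Z).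
  move=> h; apply: close_floor cx cy _; apply: le_trans hm.
  have -> : (x + L / 2) * Q%:R / L - (y + L / 2) * Q%:R / L - w%:~R * Q%:R =
     (x - y - w%:~R * L) * (Q%:R / L) by field; rewrite gt_eqF.
  rewrite normrM [`|Q%:R / L|]gtr0_norm ?divr_gt0// mulrA.
  by rewrite ler_pM2r ?invr_gt0// ler_pM2r.
move: ht; rewrite /tcoord ge_min => /orP[h|h].
  by exists 0; apply: key; rewrite mul0r subr0.
have [h0|h0] := lerP 0 (x - y).
  exists 1; apply: key; rewrite mul1r distrC.
  by move: h; rewrite ger0_norm// ger0_norm//; lra.
exists (-1); apply: key; rewrite mulN1r opprK.
by move: h; rewrite ltr0_norm// ger0_norm; lra.
Qed.

(** Both indices are below [Q], which forces [w] to be [0], [1] or [-1]; points of adjacent cells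
    differ by at most two cell widths. *)
Lemma tcoord_close L Q x y (w : int) : 0 < L -> (0 < Q)%N ->
  box L x -> box L y -> close 1 (cell L Q x)%:Z ((cell L Q y)%:Z + w * Q%:Z) ->
  tcoord L (x - y) <= 2 * (L / Q%:R).
Proof.
move=> L0 Q0 bx By nr; have Q0' : 0 < Q%:R :> R by rewrite ltr0n.
have cx := cell_itv L0 Q0 bx; have cy := cell_itv L0 Q0 By.
have dxy := box_diff bx By.
have lx := cell_lt L0 Q0 bx; have ly := cell_lt L0 Q0 By.
have key : `|x - y - w%:~R * L| <= 2 * (L / Q%:R).
  have -> : x - y - w%:~R * L = ((x + L / 2) * Q%:R / L - (y + L / 2) * Q%:R / L
      - w%:~R * Q%:R) * (L / Q%:R) by field; rewrite !gt_eqF.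
  rewrite normrM [`|L / Q%:R|]gtr0_norm ?divr_gt0//.
  rewrite ler_pM2r ?divr_gt0// ler_norml.
  move: cx cy nr; set c := cell L Q x; set c' := cell L Q y.
  rewrite -[c.+1]addn1 -[c'.+1]addn1 !natrD => cx cy [n1 n2].
  have hw : w%:~R * Q%:R = (w * Q%:Z)%:~R :> R by rewrite intrM.
  have e1 : (c%:Z - (c'%:Z + w * Q%:Z))%:~R <= 1 :> R by rewrite -(mulr1z 1) ler_int.
  have e2 : (c'%:Z + w * Q%:Z - c%:Z)%:~R <= 1 :> R by rewrite -(mulr1z 1) ler_int.
  rewrite hw; move: e1 e2; rewrite !(intrD, intrN); lra.
have w3 : [|| w == 0, w == 1 | w == -1].
  by move: nr; rewrite /close; nia.
rewrite /tcoord ge_min; apply/orP; move: key.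
case/or3P: w3 => /eqP ->.
- by rewrite mul0r subr0 => h; left.
- rewrite mul1r distrC => h; right; apply: le_trans h.
  by have := lerB_dist L (x - y); rewrite (ger0_norm (ltW L0)).
- rewrite mulN1r opprK => h; right; apply: le_trans h.
  have := lerB_dist L (y - x); rewrite [`|y - x|]distrC (ger0_norm (ltW L0)).
  by have -> : L - (y - x) = x - y + L by ring.
Qed.

Lemma tcoord_le_tdist L (p q : R * R) :
  tcoord L (p.1 - q.1) <= tdist L p q /\ tcoord L (p.2 - q.2) <= tdist L p q.
Proof.
by split; apply: le_trans (ler_norm _) _; rewrite -sqrtr_sqr /tdist;
  apply: ler_wsqrtr; rewrite ?lerDl ?lerDr sqr_ge0.
Qed.

Lemma tcoord_ge0 L x y : box L x -> box L y -> 0 <= tcoord L (x - y).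
Proof.
move=> bx By; have := box_diff bx By => /andP[h1 h2].
rewrite /tcoord le_min normr_ge0/= subr_ge0 ler_norml; lra.
Qed.

(** [sqrt (2 ^ 2 + 2 ^ 2) <= 3]; this is the factor [3] in the lower bound on the radius. *)
Lemma tdist_le L (p q : R * R) (a : R) : 0 <= a ->
  0 <= tcoord L (p.1 - q.1) <= 2 * a -> 0 <= tcoord L (p.2 - q.2) <= 2 * a ->
  tdist L p q <= 3 * a.
Proof.
move=> a0 /andP[h1 h2] /andP[h3 h4]; rewrite /tdist.
have -> : 3 * a = Num.sqrt ((3 * a) ^+ 2) by rewrite sqrtr_sqr ger0_norm// mulr_ge0.
apply: ler_wsqrtr; move: h1 h2 h3 h4.
set u := tcoord _ _; set v := tcoord _ _ => h1 h2 h3 h4.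
have : u ^+ 2 <= (2 * a) ^+ 2 by rewrite ler_pXn2r ?nnegrE// mulr_ge0.
have : v ^+ 2 <= (2 * a) ^+ 2 by rewrite ler_pXn2r ?nnegrE// mulr_ge0.
rewrite !exprMn; have : 0 <= a ^+ 2 by exact: sqr_ge0.
lra.
Qed.

Lemma cell_div L Q (m : nat) x : 0 < L -> (0 < Q)%N -> (0 < m)%N -> box L x ->
  (cell L (m * Q) x %/ m)%N = cell L Q x.
Proof.
move=> L0 Q0 m0 bx; have mQ0 : (0 < m * Q)%N by rewrite muln_gt0 m0.
have c1 := cell_itv L0 mQ0 bx; have c2 := cell_itv L0 Q0 bx.
move: c1 c2; set c := cell L _ x; set c' := cell L Q x; set a := (x + L / 2) * Q%:R / L.
have -> : (x + L / 2) * (m * Q)%:R / L = m%:R * a by rewrite natrM /a; ring.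
have m0' : 0 < m%:R :> R by rewrite ltr0n.
clearbody a => /andP[h1 h2] /andP[h3 h4].
have e1 : (m * c' < c.+1)%N.
  by rewrite -(ltr_nat R) natrM; apply: le_lt_trans h2; rewrite ler_pM2l.
have e2 : (c < m * c'.+1)%N.
  by rewrite -(ltr_nat R) natrM; apply: le_lt_trans h1 _; rewrite ltr_pM2l.
apply/eqP; rewrite eqn_leq leq_divRL// -ltnS ltn_divLR//.
by apply/andP; split; lia.
Qed.

End TorusGeometry.

(** * The hierarchy on the torus: cells, blocks and coarse cells *)

Definition nscale (bn : nat -> nat) j := (\prod_(i < j) bn i)%N.

Lemma nscale_gt0 (bn : nat -> nat) j : (forall i, (20 <= bn i)%N) ->
  (0 < nscale bn j)%N.
Proof. by move=> h; apply: prodn_gt0 => i; have := h i; lia. Qed.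

Lemma nscaleE (bn : nat -> nat) j :
  scale (fun i => (bn i)%:Z) j = (nscale bn j)%:Z.
Proof.
elim: j => [|j IH] /=; first by rewrite /nscale big_ord0.
by rewrite IH /nscale big_ord_recr /= PoszM.
Qed.

Section TorusRenormalization.
Variables (R : realType) (L r : R) (s : seq (R * R)) (k q : nat) (bn : nat -> nat).
Hypothesis L0 : 0 < L.
Hypothesis sb : in_box L s.
Hypothesis bn_ge : forall j, (20 <= bn j)%N.
Hypothesis q_ge : (5 <= q)%N.
Let b j : int := (bn j)%:Z.
Let M := (q * nscale bn k)%N.
(** A block has side [L / M] and is cut into [6 x 6] cells. The lower bound makes distinct points of
    adjacent cells neighbours in the graph; the upper bound keeps edges between blocks at sup
    distance at most [1]. *)
Hypothesis r_lo : 3 * (L / (6 * M)%:R) <= r.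
Hypothesis r_hi : r * M%:R / L <= 1.

Let vertex := 'I_(size s).
Let conn (v v' : vertex) : Prop := connect (adj L r (s := s)) v v'.

(** Cells are indexed by the whole plane, a vertex lying in every translate of its cell by the
    period [Q]; the renormalization on the plane then applies. *)
Definition in_cell Q (v : vertex) (c : int * int) : Prop :=
  exists w1 w2 : int, (cell L Q (pos v).1)%:Z = c.1 + w1 * Q%:Z /\
                      (cell L Q (pos v).2)%:Z = c.2 + w2 * Q%:Z.

Definition empty_cell Q c := forall v, ~ in_cell Q v c.

Definition bad_block (z : int * int) : Prop :=
  exists2 c : int * int, c \in square (6 * z.1) (6 * z.2) 6 & empty_cell (6 * M) c.

Let blk := in_cell M.
Let bad0 := bad_block.

Let b_ge j : 20 <= b j. Proof. by rewrite /b; have := bn_ge j; lia. Qed.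

Let M_gt0 : (0 < M)%N.
Proof. by rewrite /M muln_gt0 nscale_gt0// andbT; lia. Qed.

Let pos_box (v : vertex) : box L (pos v).1 /\ box L (pos v).2.
Proof. by apply: sb; rewrite /pos mem_nth. Qed.

Lemma adj_sym : symmetric (adj L r (s := s)).
Proof.
move=> u v; rewrite /adj eq_sym; congr (_ && (_ <= _)); rewrite /tdist /tcoord.
by rewrite distrC [`|_.2 - _|]distrC.
Qed.

Let conn_sym u v : conn u v -> conn v u.
Proof. by rewrite /conn (sym_connect_sym adj_sym). Qed.

Let conn_trans u v w : conn u v -> conn v w -> conn u w.
Proof. exact: connect_trans. Qed.

Let conn_refl v : conn v v. Proof. exact: connect0. Qed.

Let in_cell_fine v c : in_cell (6 * M) v c -> blk v (block_of c).
Proof.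
case=> w1 [w2 [h1 h2]]; exists w1, w2; have [b1 b2] := pos_box v.
have M6 : (0 < 6)%N by [].
have e1 := cell_div L0 M_gt0 M6 b1; have e2 := cell_div L0 M_gt0 M6 b2.
rewrite /block_of /= -e1 -e2; move: h1 h2.
set a1 := cell L (6 * M) _; set a2 := cell L (6 * M) _ => h1 h2.
split; first by have := divz_bounds c.1 (isT : 0 < 6 :> int); lia.
by have := divz_bounds c.2 (isT : 0 < 6 :> int); lia.
Qed.

Let blk_fine v z : blk v z ->
  exists2 c : int * int, c \in square (6 * z.1) (6 * z.2) 6 & in_cell (6 * M) v c.
Proof.
case=> w1 [w2 [h1 h2]]; have [b1 b2] := pos_box v.
have M6 : (0 < 6)%N by [].
have e1 := cell_div L0 M_gt0 M6 b1; have e2 := cell_div L0 M_gt0 M6 b2.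
exists ((cell L (6 * M) (pos v).1)%:Z - w1 * (6 * M)%:Z,
        (cell L (6 * M) (pos v).2)%:Z - w2 * (6 * M)%:Z).
  rewrite mem_square; cbn [fst snd]; move: e1 e2 h1 h2.
  by rewrite PoszM; lia.
by exists w1, w2; split; rewrite subrK.
Qed.

Let blk_nonempty z : ~ bad0 z -> exists v, blk v z.
Proof.
move=> nb; apply: contrapT => no; apply: nb.
exists (6 * z.1, 6 * z.2); first by rewrite mem_square; cbn [fst snd]; lia.
move=> v /in_cell_fine bv; apply: no; exists v.
rewrite (_ : z = block_of (6 * z.1, 6 * z.2))//; case: z {bv} => z1 z2.
by rewrite /block_of /=; congr pair; apply/esym/divz_uniq => //; lia.
Qed.

Let adj_conn (v v' : vertex) c c' : side_adj c c' ->
  in_cell (6 * M) v c -> in_cell (6 * M) v' c' -> conn v v'.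
Proof.
move=> adj_cc [w1 [w2 [h1 h2]]] [w1' [w2' [h1' h2']]].
have [->|nvv] := eqVneq v v'; first exact: conn_refl.
have M6 : (0 < 6 * M)%N by rewrite muln_gt0.
have [b1 b2] := pos_box v; have [b1' b2'] := pos_box v'.
have c1 : close 1 (cell L (6 * M) (pos v).1)%:Z
    ((cell L (6 * M) (pos v').1)%:Z + (w1 - w1') * (6 * M)%:Z).
  by rewrite h1 h1' mulrBl; case: adj_cc; rewrite /close; lia.
have c2 : close 1 (cell L (6 * M) (pos v).2)%:Z
    ((cell L (6 * M) (pos v').2)%:Z + (w2 - w2') * (6 * M)%:Z).
  by rewrite h2 h2' mulrBl; case: adj_cc; rewrite /close; lia.
apply: connect1; rewrite /adj nvv /=; apply: le_trans r_lo.
have a0 : 0 <= L / (6 * M)%:R by rewrite divr_ge0 ?ler0n// ltW.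
apply: tdist_le => //; rewrite tcoord_ge0//=.
  exact: tcoord_close L0 M6 b1 b1' c1.
exact: tcoord_close L0 M6 b2 b2' c2.
Qed.

Let cell_linked (c c' : int * int) := [/\ ~ empty_cell (6 * M) c,
  ~ empty_cell (6 * M) c' & forall v v', in_cell (6 * M) v c ->
    in_cell (6 * M) v' c' -> conn v v'].

(** The cells of two adjacent good blocks are all occupied and fill a rectangle, whose connectivity
    is used with an empty window. *)
Let blk_conn z z' v v' : ~ bad0 z -> ~ bad0 z' -> side_adj z z' ->
  blk v z -> blk v' z' -> conn v v'.
Proof.
move=> nz nz' adj_zz /blk_fine[c cz vc] /blk_fine[c' cz' vc'].
suff [_ _ H] : cell_linked c c' by exact: H vc vc'.
rewrite !mem_square in cz cz'.
apply: (@rect_connected cell_linked (fun=> False) (fun=> False)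
  (Num.min (6 * z.1) (6 * z'.1)) (Num.max (6 * z.1) (6 * z'.1) + 6)
  (Num.min (6 * z.2) (6 * z'.2)) (Num.max (6 * z.2) (6 * z'.2) + 6)).
- by move=> u w [h1 h2 h]; split=> // x x' hx hx'; apply/conn_sym/h.
- move=> u w t [h1 h2 h] [_ h4 h']; split=> // x x' hx hx'.
  have [y hy] : exists y, in_cell (6 * M) y w by apply: contrapT => no; apply: h2 => y hy; apply: no; exists y.
  exact: conn_trans (h _ _ hx hy) (h' _ _ hy hx').
- have nonempty (u : int * int) : (Num.min (6 * z.1) (6 * z'.1) <= u.1 < Num.max (6 * z.1) (6 * z'.1) + 6)
     && (Num.min (6 * z.2) (6 * z'.2) <= u.2 < Num.max (6 * z.2) (6 * z'.2) + 6) ->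
     ~ empty_cell (6 * M) u.
    move=> ru eu; have : (u \in square (6 * z.1) (6 * z.2) 6) || (u \in square (6 * z'.1) (6 * z'.2) 6).
      by move: ru; rewrite !mem_square; case: adj_zz => -[]; rewrite /close => h1 h2; lia.
    by case/orP => uz; [apply: nz|apply: nz']; exists u.
  move=> u w ru rw adj_uw _ _; split; [exact: nonempty|exact: nonempty|].
  by move=> x x'; exact: adj_conn.
- by exists (6 * z.1) => //; lia.
- by exists (6 * z.2) => //; lia.
- by move: cz; lia.
- by move: cz'; lia.
- by case.
- by case.
Qed.

Let lift_adj (v v' : vertex) z : adj L r v v' -> blk v z ->
  exists2 z', blk v' z' & close2 1 z z'.
Proof.
case/andP => _ dr [w1 [w2 [h1 h2]]].
have [b1 b2] := pos_box v; have [b1' b2'] := pos_box v'.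
have [t1 t2] := tcoord_le_tdist L (pos v) (pos v').
have [x1 c1] := cell_close (m := 1) L0 M_gt0 b1 b1' (le_trans t1 dr) r_hi.
have [x2 c2] := cell_close (m := 1) L0 M_gt0 b2 b2' (le_trans t2 dr) r_hi.
(* The cell of [v'] is shifted by the multiple of [M] that brings it next to [z]. *)
exists ((cell L M (pos v').1)%:Z + (x1 - w1) * M%:Z,
        (cell L M (pos v').2)%:Z + (x2 - w2) * M%:Z).
  by exists (w1 - x1), (w2 - x2) => /=; split; lia.
by move: c1 c2; rewrite h1 h2 /close2 /close /=; lia.
Qed.

Let lift_connect (v v' : vertex) z : connect (adj L r (s := s)) v v' -> blk v z ->
  exists g T, [/\ lifted_path conn blk g T, g 0%N = (v, z) & (g T).1 = v'].
Proof.
case/connectP => p; elim: p v z => [|u p IH] v z /=.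
  by move=> _ -> bv; exists (fun=> (v, z)), 0%N; split=> //; split=> // t; rewrite ltn0.
case/andP => avu pu lu bv; have [z' bu cz] := lift_adj avu bv.
have [g [T [[bg sg] g0 gT]]] := IH u z' pu lu bu.
exists (fun t => if t is t'.+1 then g t' else (v, z)), T.+1; split=> //; split.
  by case=> [|t] //=; exact: bg.
case=> [_|t] /=; last exact: sg.
by rewrite g0; split=> //; exact: connect1.
Qed.

Let anc_div z : anc b k z = ((z.1 %/ (nscale bn k)%:Z)%Z, (z.2 %/ (nscale bn k)%:Z)%Z).
Proof.
rewrite -nscaleE; elim: k => [|j IH] /=; first by rewrite !divz1 -surjective_pairing.
by rewrite IH /= !divzMA_ge0// nscaleE.
Qed.

(** Modulo [q], a box of level [k] is a cell of the [q x q] grid. *)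
Let coarse (v : vertex) z : blk v z -> exists w1 w2 : int,
  anc b k z = ((cell L q (pos v).1)%:Z + w1 * q%:Z, (cell L q (pos v).2)%:Z + w2 * q%:Z).
Proof.
case=> w1 [w2 [h1 h2]]; exists (- w1), (- w2); have [b1 b2] := pos_box v.
have q0 : (0 < q)%N by lia.
rewrite anc_div -(cell_div L0 q0 (nscale_gt0 k bn_ge) b1) -(cell_div L0 q0 (nscale_gt0 k bn_ge) b2).
rewrite [(nscale bn k * q)%N]mulnC -/M.
have P0 : 0 < (nscale bn k)%:Z by have := nscale_gt0 k bn_ge; lia.
have aux (a c w : int) : a = c + w * M%:Z -> (c %/ (nscale bn k)%:Z)%Z = (a %/ (nscale bn k)%:Z)%Z + - w * q%:Z.
  move=> ->; apply: divz_uniq => //; rewrite /M PoszM.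
  have := divz_bounds (c + w * (q%:Z * (nscale bn k)%:Z)) P0.
  by set d := (_ %/ _)%Z; lia.
by congr pair; rewrite (aux _ _ _ h1, aux _ _ _ h2) -divz_nat.
Qed.

Hypothesis good : forall U, ~ bad bad0 b k U.

(** All cores of level [k] are linked, so one component contains them. A vertex outside it has no
    path escaping the [3 x 3] neighbourhood of its box, as such a path would meet a core. *)
Lemma renormalized_giant : exists v0 : vertex,
  (q * q * core_density b k <= #|Defs.comp L r v0|)%N /\
  (forall v : vertex, v \notin Defs.comp L r v0 ->
   forall v', v' \in Defs.comp L r v -> exists w1 w2 : int,
     close 1 (cell L q (pos v').1)%:Z ((cell L q (pos v).1)%:Z + w1 * q%:Z) /\
     close 1 (cell L q (pos v').2)%:Z ((cell L q (pos v).2)%:Z + w2 * q%:Z)).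
Proof.
have linked_all := core_linked_all conn_sym conn_trans blk_nonempty blk_conn b_ge good.
have [[z0 cz0] _ _] := linked_all (0, 0) (0, 0).
have core_nb U z : core bad0 b k U z -> ~ bad0 z := @core_not_bad0 _ _ _ _ _ (@good U).
have [v0 bv0] := blk_nonempty (core_nb _ _ cz0).
exists v0; split.
  have /choice[f fP] : forall U, exists t : seq (int * int),
     [/\ uniq t, forall z, z \in t -> core bad0 b k U z & (core_density b k <= size t)%N].
    by move=> U; exact: (core_count b_ge (good (U := U))).
  pose t := flatten (map f (square 0 0 q)).
  have ut : uniq t.
    apply: uniq_flatten_map; [exact: square_uniq|by move=> U _; case: (fP U)|].
    move=> U U' z _ _ zU zU'; have [_ h _] := fP U; have [_ h' _] := fP U'.
    by rewrite -(core_anc b_ge (h _ zU)) -(core_anc b_ge (h' _ zU')).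
  have st : (q * q * core_density b k <= size t)%N.
    rewrite /t -(size_square 0 0); elim: (square _ _ _) => [|a l IH] //=.
    by rewrite size_cat mulSn leq_add//; case: (fP a).
  apply: leq_trans st _.
  have tP z : z \in t -> exists2 U, U \in square 0 0 q & core bad0 b k U z.
    by case/flatten_mapP => U Us zU; exists U => //; case: (fP U) => _ h _; exact: h.
  have /choice[g gP] : forall z, exists v, z \in t -> blk v z.
    move=> z; have [zt|nt] := pselect (z \in t); last by exists v0.
    by have [U _ /core_nb/blk_nonempty[v bv]] := tP z zt; exists v.
  rewrite -(size_map g) cardE; apply: uniq_leq_size.
    rewrite map_inj_in_uniq// => z z' zt zt' e.
    have [w1 [w2 [h1 h2]]] := gP _ zt; have [w1' [w2' [h1' h2']]] := gP _ zt'.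
    rewrite e in h1 h2.
    (* Blocks with ancestors in the [q x q] square lie in one fundamental domain, so two of them
       sharing a vertex coincide. *)
    have in_torus (y : int * int) : y \in t -> (0 <= y.1 < M%:Z) && (0 <= y.2 < M%:Z).
      case/tP => U; rewrite mem_square => Us /(core_anc b_ge).
      rewrite anc_div => eU; move: Us; rewrite -eU /=.
      have P0 : 0 < (nscale bn k)%:Z by have := nscale_gt0 k bn_ge; lia.
      have := divz_bounds y.1 P0; have := divz_bounds y.2 P0.
      set d1 := (_ %/ _)%Z; set d2 := (_ %/ _)%Z; rewrite /M PoszM => B1 B2 Us.
      have : (nscale bn k)%:Z * d1 <= (nscale bn k)%:Z * (q%:Z - 1) by rewrite ler_pM2l//; lia.
      have : (nscale bn k)%:Z * d2 <= (nscale bn k)%:Z * (q%:Z - 1) by rewrite ler_pM2l//; lia.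
      have : 0 <= (nscale bn k)%:Z * d1 by rewrite pmulr_rge0//; lia.
      have : 0 <= (nscale bn k)%:Z * d2 by rewrite pmulr_rge0//; lia.
      clear -B1 B2; lia.
    have aux (a c w w' : int) : 0 <= a < M%:Z -> 0 <= c < M%:Z ->
        a + w * M%:Z = c + w' * M%:Z -> a = c.
      move=> ha hc h; have hM : 0 < M%:Z by have := M_gt0; lia.
      have e1 : (w - w') * M%:Z < 1 * M%:Z by lia.
      have e2 : -1 * M%:Z < (w - w') * M%:Z by lia.
      move: e1 e2; rewrite !ltr_pM2r// => e1 e2.
      have ww : w = w' by lia.
      by move: h; rewrite ww; lia.
    have /andP[i1 i2] := in_torus _ zt; have /andP[i1' i2'] := in_torus _ zt'.
    rewrite [z]surjective_pairing [z']surjective_pairing; congr pair.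
      by apply: (aux _ _ w1 w1') => //; rewrite -h1 -h1'.
    by apply: (aux _ _ w2 w2') => //; rewrite -h2 -h2'.
  move=> v /mapP[z zt ->]; rewrite mem_enum inE.
  have [U _ cz] := tP _ zt; have [_ _ H] := linked_all (0, 0) U.
  by have [_ _ Hz] := H _ _ cz0 cz; exact: Hz bv0 (gP _ zt).
move=> v; rewrite inE => nv v'; rewrite inE => vv'.
have bv : blk v ((cell L M (pos v).1)%:Z, (cell L M (pos v).2)%:Z).
  by exists 0, 0; rewrite !mul0r !addr0.
have [g [T [pg g0 gT]]] := lift_connect vv' bv.
have [bgT _] := pg; have := bgT T (leqnn T); rewrite gT => /coarse[w1 [w2 e1]].
have [x1 [x2 e2]] := coarse bv.
have [|far] := pselect (close2 1 (anc b k (g T).2) (anc b k (g 0%N).2)).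
  rewrite e1 g0 e2 => -[] /= c1 c2; exists (x1 - w1), (x2 - w2).
  by move: c1 c2; rewrite /close; lia.
exfalso; move/negP: nv; apply; rewrite (sym_connect_sym adj_sym).
have [[z cz] _ _] := linked_all (anc b k (g 0%N).2) (anc b k (g 0%N).2).
have [x bx] := blk_nonempty (core_nb _ _ cz).
have := escaping_path_meets_core conn_sym conn_trans blk_nonempty blk_conn b_ge
   conn_refl (@good _) pg erefl far cz bx.
rewrite g0 => cvx; apply: conn_trans cvx _.
have [_ _ H] := linked_all (0, 0) (anc b k (g 0%N).2).
by have [_ _ Hz] := H _ _ cz0 cz; apply: conn_sym; exact: Hz bv0 bx.
Qed.

End TorusRenormalization.

(** * Existence of the giant regime for large radii *)

(** The sides grow fast enough for the lost proportions [17 ^ 2 / bn j ^ 2] to be summable, and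
    slowly enough for [nscale bn k] to be at most [2 ^ (6 * k + k ^ 2)]. *)
Definition bn (j : nat) : nat := (2 ^ (j + 6))%N.

Lemma bn_ge j : (20 <= bn j)%N.
Proof. by rewrite /bn expnD; have := expn_gt0 2 j; lia. Qed.

(** The induction proves the proportion [(1 + 2 ^ (- j)) / 2], whose decrease from one level to the
    next pays for the [289 = 17 * 17] lost children. *)
Lemma core_density_ge j :
  (nscale bn j ^ 2 <= 2 * core_density (fun i => (bn i)%:Z) j)%N.
Proof.
suff : ((2 ^ j + 1) * nscale bn j ^ 2 <= 2 * 2 ^ j * core_density (fun i => (bn i)%:Z) j)%N.
  set D := core_density _ j; set P := nscale bn j => h.
  rewrite -(leq_pmul2l (expn_gt0 2 j)); apply: leq_trans (leq_trans h _).
    by rewrite leq_mul2r leq_addr orbT.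
  by rewrite mulnCA mulnA.
elim: j => [|j IH]; first by rewrite /nscale big_ord0.
rewrite /nscale big_ord_recr /= -/(nscale bn j) expnMn.
move: IH; set D := core_density _ j; set P := (nscale bn j ^ 2)%N => IH.
have h1 : (578 * (2 ^ j + 1) <= bn j ^ 2)%N.
  rewrite /bn -expnM mulnDl expnD [(2 ^ (j * 2))%N]expnM -[(6 * 2)%N]/12%N.
  by have := expn_gt0 2 j; rewrite -[(2 ^ 12)%N]/4096%N; set x := (2 ^ j)%N; nia.
rewrite expnS; set x := (2 ^ j)%N in IH h1 *; set y := bn j in h1 *.
have e : (`|y%:Z| * `|y%:Z| = y ^ 2)%N by rewrite absz_nat mulnn.
rewrite e; move: h1; set Y := (y ^ 2)%N => h1.
have h2 : ((2 * x + 1) * Y <= 2 * (Y - 289) * (x + 1))%N by nia.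
have h3 : ((2 * x + 1) * Y * P <= 2 * (Y - 289) * ((x + 1) * P))%N.
  by rewrite mulnA leq_mul2r h2 orbT.
have h4 : (2 * (Y - 289) * ((x + 1) * P) <= 2 * (Y - 289) * (2 * x * D))%N.
  by rewrite leq_mul2l IH orbT.
have := leq_trans h3 h4; rewrite -[(17 * 17)%N]/289%N.
set Z := (Y - 289)%N => h5; clearbody Z.
have -> : ((2 * x + 1) * (P * Y) = (2 * x + 1) * Y * P)%N by ring.
by have -> : (2 * (2 * x) * (Z * D) = 2 * Z * (2 * x * D))%N by ring.
Qed.

(** Since [(3 * 2 ^ (j + 6)) ^ 4 = a * 16 ^ j] with [a = 192 ^ 4], the count obeys
    [w_(j+1) = a * 16 ^ j * w_j ^ 2], and [w_j * a * 16 ^ (j + 1)] is exactly squared at each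
    step. *)
Lemma witness_count_le : exists A : nat,
  forall j, (witness_count (fun i => (bn i)%:Z) j <= A ^ (2 ^ j))%N.
Proof.
have [a ea] : exists a : nat, a = (192 ^ 4)%N by eexists.
have [A eA] : exists A : nat, A = (36 * (a * 16))%N by eexists.
exists A => j.
suff : (witness_count (fun i => (bn i)%:Z) j * (a * 16 ^ j.+1) <= A ^ (2 ^ j))%N.
  by apply: leq_trans; rewrite leq_pmulr// muln_gt0 ea !expn_gt0.
elim: j => [|j IH].
  by rewrite -[witness_count _ 0]/36%N expn0 !expn1 eA leqnn.
rewrite [witness_count _ _]/=; move: IH; set w := witness_count _ j.
move=> IH; have -> : (A ^ (2 ^ j.+1) = A ^ (2 ^ j) * A ^ (2 ^ j))%N.
  by rewrite expnS mulnC expnM -mulnn.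
have -> : ((3 * `|(bn j)%:Z|) ^ 4 = a * 16 ^ j)%N.
  rewrite absz_nat /bn expnD mulnCA [LHS]expnMn ea [RHS]mulnC; congr (_ * _)%N.
  by rewrite -expnM mulnC expnM.
apply: leq_trans (leq_mul IH IH).
rewrite !expnS; set x := (16 ^ j)%N; clearbody x w.
by rewrite leq_eqVlt; apply/orP; left; apply/eqP; ring.
Qed.

Lemma nscale_le k : (nscale bn k <= 2 ^ (6 * k + k * k))%N.
Proof.
elim: k => [|k IH]; first by rewrite /nscale big_ord0.
rewrite /nscale big_ord_recr /= -/(nscale bn k) /bn.
apply: leq_trans (leq_mul IH (leqnn _)) _; rewrite -expnD leq_exp2l//; lia.
Qed.

Lemma poly_le_exp2 k : (10 <= k)%N -> (14 * k + 2 * (k * k) <= 2 ^ k.-1)%N.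
Proof.
elim: k => [|k IH] //; rewrite leq_eqVlt => /predU1P[<-//|hk].
by have := IH hk; case: k {IH} hk => // k hk; rewrite /= [(2 ^ k.+1)%N]expnS; lia.
Qed.

(** For the least [k] with [n < 2 ^ (2 ^ k)], minimality gives [n >= 2 ^ (2 ^ (k - 1))], which
    exceeds the bound [2 ^ (14 * k + 2 * k ^ 2)] on [(K * nscale bn k) ^ 2]. *)
Lemma scale_choice (K : nat) : exists N : nat, forall n, (N <= n)%N ->
  exists k, ((K * nscale bn k) ^ 2 <= n < 2 ^ (2 ^ k))%N.
Proof.
pose k0 := maxn 10 K; exists (2 ^ (2 ^ k0))%N => n hn.
have ex : exists k, (n < 2 ^ (2 ^ k))%N.
  exists n; apply: leq_trans (ltn_expl n (isT : 1 < 2)%N) _.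
  by rewrite leq_exp2l// ltnW// ltn_expl.
case: (ex_minnP ex) => k hk kmin; exists k; rewrite hk andbT.
have k0k : (k0 < k)%N.
  rewrite ltnNge; apply/negP => kk; move: hk; rewrite ltnNge => /negP; apply.
  by apply: leq_trans hn; rewrite !leq_exp2l.
have k1 : (2 ^ (2 ^ k.-1) <= n)%N.
  rewrite leqNgt; apply/negP => /kmin; lia.
apply: leq_trans k1; rewrite expnMn.
have hK : (K ^ 2 <= 2 ^ (2 * k))%N.
  rewrite [(2 * k)%N]mulnC expnM leq_exp2r//; apply: ltnW.
  by apply: leq_trans (ltn_expl K (isT : 1 < 2)%N) _; rewrite leq_exp2l//; lia.
have hP : (nscale bn k ^ 2 <= 2 ^ ((6 * k + k * k) * 2))%N.
  by rewrite expnM leq_exp2r// nscale_le.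
apply: leq_trans (leq_mul hK hP) _; rewrite -expnD leq_exp2l//.
by have := @poly_le_exp2 k ltac:(lia); lia.
Qed.

(** * Convergence to one and bounds for the exponential *)

Section Convergence.
Variable R : realType.

Lemma cvg_squeeze_one (g a : nat -> \bar R) (K : R) (N : nat) :
  g @ \oo --> 1%E -> (forall n, (N <= n)%N -> (a n <= 1)%E) ->
  (forall n, (N <= n)%N -> (g n <= a n + (K / n%:R)%:E)%E) ->
  a @ \oo --> 1%E.
Proof.
move=> g1 a1 ga.
have hK : (fun n : nat => K / n%:R) @ \oo --> (0 : R).
  rewrite -(mulr0 K); apply: cvgM; first exact: cvg_cst.
  rewrite -(cvg_shiftS (fun n : nat => (n%:R : R)^-1)) /=; exact: cvg_harmonic.
have low : (fun n => g n - (K / n%:R)%:E)%E @ \oo --> 1%E.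
  rewrite -[X in _ --> X]sube0; apply: cvgeB => //.
  by apply: cvg_EFin hK; near=> n.
apply: (squeeze_cvge _ low (cvg_cst 1%E)); near=> n.
have nN : (N <= n)%N by near: n; exists N.
by rewrite a1// andbT leeBlDr// ga.
Unshelve. all: by end_near.
Qed.

Lemma expR_ge_sqr (x : R) : 0 <= x -> x ^+ 2 / 4 <= expR x.
Proof.
move=> x0; have -> : x = x / 2 + x / 2 by lra.
rewrite expRD; have h := expR_ge1Dx (x / 2).
have : (1 + x / 2) * (1 + x / 2) <= expR (x / 2) * expR (x / 2).
  by apply: ler_pM => //; lra.
apply: le_trans; nra.
Qed.

Lemma expR1_le4 : expR 1 <= 4 :> R.
Proof.
have -> : 1 = 2^-1 + 2^-1 :> R by lra.
rewrite expRD; have h : expR (2^-1) <= 2 :> R.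
  have := expR_ge1Dx (- (2^-1) : R); rewrite expRN => h.
  have e0 := expR_gt0 (2^-1 : R).
  have : 2^-1 * expR 2^-1 <= 1 :> R.
    rewrite -ler_pdivlMr// div1r; apply: le_trans h; lra.
  lra.
have e0 := expR_gt0 (2^-1 : R); nra.
Qed.

End Convergence.

(** * Bounds obtained by weighting the points of chosen cells *)

Section TiltedProducts.
Variable R : realType.
Implicit Types (T : seq (nat * nat)) (u L : R) (Q : nat).

Lemma iint_cst1 L k : 0 < L -> iint L k (fun=> 1%E) = (((L ^+ 2) ^+ k)%:E : \bar R).
Proof.
move=> L0; elim: k => [|k IH]; first by rewrite expr0.
transitivity (\int[lebesgue_measure]_(x in box L) (L * (L ^+ 2) ^+ k)%:E)%E.
  apply: eq_integral => x _.
  transitivity (\int[lebesgue_measure]_(y in box L) ((L ^+ 2) ^+ k)%:E)%E.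
    by apply: eq_integral => y _; exact: IH.
  rewrite (integral_comp_cell (psi := fun=> (L ^+ 2) ^+ k) L0 (isT : (0 < 1)%N))//.
    by rewrite big_ord1 divr1.
  by move=> _; rewrite exprn_ge0// exprn_ge0// ltW.
rewrite (integral_comp_cell (psi := fun=> L * (L ^+ 2) ^+ k) L0 (isT : (0 < 1)%N))//.
  by rewrite big_ord1 divr1 [in RHS]exprS; congr EFin; ring.
by move=> _; rewrite mulr_ge0 ?exprn_ge0// ?exprn_ge0// ltW.
Qed.

Lemma ppp_prob_true n : (0 < n)%N -> ppp_prob n (fun _ : seq (R * R) => True) = 1%E.
Proof.
move=> n0; rewrite ppp_probE /ppp_exp.
transitivity (\sum_(k <oo) ((poisson_pmf (n%:R : R) k) * (n%:R ^- k) * n%:R ^+ k)%:E)%E.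
  apply: eq_eseriesr => k _; rewrite asboolT// [in RHS]EFinM; congr (_ * _)%E.
  by rewrite iint_cst1 ?side_gt0// side_sqr.
by rewrite poisson_series// subrr expR0.
Qed.

Lemma ppp_prob_mono n (E E' : seq (R * R) -> Prop) :
  (forall s, in_box (side R n) s -> E s -> E' s) ->
  (ppp_prob n E <= ppp_prob n E')%E.
Proof.
move=> h; rewrite !ppp_probE; apply: le_ppp_exp => s; first by rewrite lee_fin.
move=> bs; rewrite lee_fin ler_nat; case: (asboolP (E s)) => // Es.
by rewrite asboolT//; exact: h.
Qed.

(** With [u = 0] the product functional is the indicator that no point falls in [T]; with [u > 1] it
    is an exponential moment of the number of points in [T]. *)
Definition tilt u T (i j : nat) : R := if (i, j) \in T then u else 1.

Definition occ L Q T (s : seq (R * R)) : nat :=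
  count (fun p => (cell L Q p.1, cell L Q p.2) \in T) s.

Lemma prodF_tilt L Q u T s : prodF L Q (tilt u T) s = u ^+ occ L Q T s.
Proof.
rewrite /prodF /occ; elim: s => [|p s IH]; first by rewrite big_nil expr0.
rewrite big_cons IH /= exprD {1}/tilt; case: ifP => _; first by rewrite expr1.
by rewrite expr0.
Qed.

Lemma sumF_tilt Q u T : uniq T -> (forall c, c \in T -> (c.1 < Q)%N && (c.2 < Q)%N) ->
  sumF Q (tilt u T) = Q%:R ^+ 2 + (size T)%:R * (u - 1).
Proof.
elim: T => [|c T IH] /=.
  move=> _ _; rewrite /sumF /tilt mul0r addr0.
  under eq_bigr do rewrite big_const_ord iter_addr_0.
  by rewrite big_const_ord iter_addr_0 -mulrnA natrM expr2.
case/andP=> cT uT rT.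
have {}IH := IH uT (fun c' h => rT c' (mem_behead (s := c :: T) h)).
have /andP[c1 c2] := rT c (mem_head _ _).
have -> : sumF Q (tilt u (c :: T)) =
   sumF Q (tilt u T) + \sum_(i < Q) \sum_(j < Q) (if ((i : nat), (j : nat)) == c then u - 1 else 0).
  rewrite /sumF -big_split; apply: eq_bigr => i _; rewrite -big_split.
  apply: eq_bigr => j _; rewrite /tilt inE /=; case: eqP => [->|_] /=.
    by rewrite (negbTE cT); ring.
  by rewrite addr0.
rewrite IH (bigD1 (Ordinal c1))//= (bigD1 (Ordinal c2))//= -surjective_pairing eqxx.
rewrite big1; last first.
  move=> j nj; case: eqP => // e; case/negP: nj; apply/eqP/val_inj.
  by rewrite /= -e.
rewrite big1; last first.
  move=> i ni; rewrite big1// => j _; case: eqP => // e; case/negP: ni.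
  by apply/eqP/val_inj; rewrite /= -e.
by rewrite -[(size T).+1]addn1 natrD; ring.
Qed.

Lemma ppp_prob_tilt_bound n (I : eqType) (r : seq I) Q (T : I -> seq (nat * nat))
    (c : I -> R) u (G E : seq (R * R) -> Prop) :
  (0 < n)%N -> (0 < Q)%N -> 0 <= u -> (forall t, 0 <= c t) ->
  (forall t, t \in r -> uniq (T t)) ->
  (forall t, t \in r -> forall x, x \in T t -> (x.1 < Q)%N && (x.2 < Q)%N) ->
  (forall s, in_box (side R n) s -> G s -> ~ E s ->
     1 <= \sum_(t <- r) c t * u ^+ occ (side R n) Q (T t) s) ->
  (ppp_prob n G <= ppp_prob n E +
   (\sum_(t <- r) c t * expR (n%:R / Q%:R ^+ 2 * ((size (T t))%:R * (u - 1))))%:E)%E.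
Proof.
move=> n0 Q0 u0 c0 uT rT H.
apply: le_trans (@ppp_prob_union_bound R n I r Q (fun t => tilt u (T t)) c G E _ _ _ _ _) _ => //.
- by move=> t i j; rewrite /tilt; case: ifP.
- move=> s bs Gs nEs; apply: le_trans (H s bs Gs nEs) _.
  by rewrite le_eqVlt; apply/orP; left; apply/eqP/eq_bigr => t _; rewrite prodF_tilt.
rewrite leeD2l// lee_fin big_seq_cond [leRHS]big_seq_cond le_eqVlt; apply/orP; left; apply/eqP.
apply: eq_bigr => t /andP[tr _]; rewrite sumF_tilt; [|exact: uT|exact: rT].
congr (_ * expR _); have hQ : Q%:R != 0 :> R by rewrite pnatr_eq0 -lt0n.
by field.
Qed.

Lemma occ_card L Q T (s : seq (R * R)) :
  occ L Q T s = #|[pred v : 'I_(size s) | (cell L Q (pos v).1, cell L Q (pos v).2) \in T]|.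
Proof.
rewrite /occ -sum1_count (big_nth (0, 0)) big_mkord -sum1_card.
by apply: eq_bigl => v; rewrite inE.
Qed.

End TiltedProducts.

(** * Components of the graph and the giant component *)

Section Components.
Variables (R : realType) (L r : R) (s : seq (R * R)).

(** The vertex [v] provides a component of maximal size, which excludes the default value of
    [giant]. *)
Lemma giantP (v : 'I_(size s)) : exists i, giant L r s = Defs.comp L r i /\
  forall j : 'I_(size s), (#|Defs.comp L r j| <= #|giant L r s|)%N.
Proof.
rewrite /giant; case: pickP => [C /andP[/existsP[i /eqP ->] /forallP h]|no] /=.
  by exists i.
have := no (Defs.comp L r [arg max_(i > v) #|Defs.comp L r i|]).
case: arg_maxnP => // i _ hi; rewrite (_ : [exists i0, _])/=; last first.
  by apply/existsP; exists i.
by move/negP; case; apply/forallP => j; exact: hi.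
Qed.

Lemma comp_eq (i j : 'I_(size s)) : connect (adj L r (s := s)) i j ->
  Defs.comp L r i = Defs.comp L r j.
Proof.
move=> ij; apply/setP => x; rewrite !inE.
by rewrite (same_connect (sym_connect_sym (@adj_sym R L r s)) ij).
Qed.

End Components.

Lemma eq_modz_shift (a c m : int) : (a %% m)%Z = (c %% m)%Z ->
  a = c + m * ((a %/ m)%Z - (c %/ m)%Z).
Proof.
move=> e; have := divz_eq a m; have := divz_eq c m; rewrite -e {e}.
set p := (a %/ m)%Z; set q := (c %/ m)%Z; set x := (a %% m)%Z.
by clearbody p q x => -> ->; ring.
Qed.

(** [d - 1] is the displacement; adding [q] before the predecessor avoids truncated subtraction at
    [c = d = 0]. *)
Lemma close1_mod (q c c' : nat) (w : int) : (c < q)%N -> (c' < q)%N ->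
  close 1 c'%:Z (c%:Z + w * q%:Z) -> exists d : 'I_3, c' = ((c + d + q).-1 %% q)%N.
Proof.
move=> lc lc' [k1 k2].
have w3 : [|| w == 0, w == 1 | w == -1] by nia.
have [d dE] : exists d : 'I_3, c'%:Z = c%:Z + d%:Z - 1 + w * q%:Z.
  have d3 : (absz (c'%:Z + 1 - c%:Z - w * q%:Z)%R < 3)%N by lia.
  by exists (Ordinal d3) => /=; lia.
exists d; case/or3P: w3 dE => /eqP -> dE {k1 k2}.
- rewrite (_ : (c + d + q).-1 = c' + q)%N; last by lia.
  by rewrite modnDr modn_small.
- rewrite (_ : (c + d + q).-1 = c')%N; last by lia.
  by rewrite modn_small.
- rewrite (_ : (c + d + q).-1 = c' + q + q)%N; last by lia.
  by rewrite !modnDr modn_small.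
Qed.

(** * Probability of the good event, and the giant component on it *)

Section Supercritical.
Variable R : realType.
Implicit Types (s : seq (R * R)) (n k q : nat).
Let b i : int := (bn i)%:Z.
Let b_ge j : 20 <= b j. Proof. by rewrite /b; have := bn_ge j; lia. Qed.

Definition good_event n k q s :=
  forall U, ~ bad (@bad_block R (side R n) s k q bn) b k U.

Lemma bad_block_periodic (L : R) s k q (z : int * int) (w1 w2 : int) :
  bad_block L s k q bn (z.1 + (q * nscale bn k)%:Z * w1, z.2 + (q * nscale bn k)%:Z * w2) ->
  bad_block L s k q bn z.
Proof.
set M := (q * nscale bn k)%N => -[c]; rewrite mem_square; cbn [fst snd] => cs ec.
exists (c.1 - (6 * M)%:Z * w1, c.2 - (6 * M)%:Z * w2).
  move: cs; rewrite mem_square; cbn [fst snd]; rewrite PoszM -!mulrA.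
  by set X := M%:Z * w1; set Y := M%:Z * w2; clearbody X Y; lia.
move=> v [x1 [x2 [h1 h2]]]; apply: (ec v); exists (x1 - w1), (x2 - w2).
by move: h1 h2; cbn [fst snd]; lia.
Qed.

Lemma bad_in_fundamental_domain (L : R) s k q U : (0 < q)%N ->
  bad (bad_block L s k q bn) b k U ->
  exists2 U', U' \in square 0 0 q & bad (bad_block L s k q bn) b k U'.
Proof.
move=> q0 bU; have q0' : 0 < q%:Z by lia.
have q1 : q%:Z != 0 by lia.
exists ((U.1 %% q)%Z, (U.2 %% q)%Z).
  rewrite mem_square; cbn [fst snd]; rewrite !modz_ge0// !add0r !ltz_pmod//.
pose m j : int := (q * (nscale bn k %/ nscale bn j))%:Z.
have sdvd j : (j <= k)%N -> (nscale bn j %| nscale bn k)%N.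
  elim: k {bU m} => [|i IH]; first by rewrite leqn0 => /eqP ->.
  rewrite leq_eqVlt => /predU1P[->//|/IH h].
  by rewrite [nscale _ i.+1]/nscale big_ord_recr /= dvdn_mulr.
have s0 j : (0 < nscale bn j)%N by apply: nscale_gt0; exact: bn_ge.
have m0 : m 0%N = (q * nscale bn k)%:Z by rewrite /m [nscale bn 0]/nscale big_ord0 divn1.
have mk : m k = q%:Z by rewrite /m divnn s0 muln1.
apply: (@bad_periodic (bad_block L s k q bn) b m k _ _ k _ (U.1 %/ q)%Z (U.2 %/ q)%Z) => //.
- by move=> z w1 w2; rewrite m0; exact: bad_block_periodic.
- move=> j jk; rewrite /m /b -PoszM; congr Posz.
  have /dvdnP[x xE] := sdvd _ jk; rewrite xE mulnK// mulnCA; congr (_ * _)%N.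
  rewrite [nscale _ j.+1]/nscale big_ord_recr /= -/(nscale bn j).
  by rewrite [(nscale bn j * _)%N]mulnC mulnA mulnK// mulnC.
- rewrite mk; cbn [fst snd]; rewrite [U]surjective_pairing in bU.
  have e1 : (U.1 %% q)%Z + q%:Z * (U.1 %/ q)%Z = U.1 by have := divz_eq U.1 q; lia.
  have e2 : (U.2 %% q)%Z + q%:Z * (U.2 %/ q)%Z = U.2 by have := divz_eq U.2 q; lia.
  by rewrite e1 e2.
Qed.

(** A Peierls argument: [good_event] fails only if all [2 ^ k] cells of some witness of a box in the
    fundamental domain are empty, and with [u = 0] a witness contributes [exp] of minus its area. *)
Lemma ppp_prob_good n k q : (0 < n)%N -> (5 <= q)%N ->
  (ppp_prob n (fun _ : seq (R * R) => True) <= ppp_prob n (good_event n k q) +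
   ((q * q * witness_count b k)%:R *
     expR (- (n%:R / (6 * (q * nscale bn k))%:R ^+ 2 * (2 ^ k)%:R)))%:E)%E.
Proof.
move=> n0 q5; set M := (q * nscale bn k)%N; set Q := (6 * M)%N.
have s0 : (0 < nscale bn k)%N by apply: nscale_gt0; exact: bn_ge.
have Q0 : (0 < Q)%N by rewrite /Q /M; lia.
have Q0' : Q%:Z != 0 by lia.
have Q1 : 0 < Q%:Z by lia.
pose W := flatten [seq witnesses b k U | U <- square 0 0 q].
pose red (c : int * int) : nat * nat := (absz (c.1 %% Q)%Z, absz (c.2 %% Q)%Z).
have WP S : S \in W -> exists U, S \in witnesses b k U.
  by case/flatten_mapP => U _ h; exists U.
have redE c : ((red c).1%:Z = (c.1 %% Q)%Z) * ((red c).2%:Z = (c.2 %% Q)%Z).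
  by rewrite /red /= !gez0_abs// modz_ge0.
have sW : (size W <= q * q * witness_count b k)%N.
  rewrite /W -(size_square 0 0 q); elim: (square 0 0 q) => [|a l IH] //=.
  by rewrite size_cat mulSn leq_add// size_witnesses.
apply: le_trans (@ppp_prob_tilt_bound R n _ W Q (map red) (fun=> 1) 0
   (fun=> True) (good_event n k q) n0 Q0 _ _ _ _ _) _ => //.
- move=> S /WP[U /(witnessP b_ge)[_ uS nS]]; rewrite map_inj_in_uniq// => c c' cS cS' e.
  have e1 : (c.1 %% Q)%Z = (c'.1 %% Q)%Z by rewrite -!redE e.
  have e2 : (c.2 %% Q)%Z = (c'.2 %% Q)%Z by rewrite -!redE e.
  pose w1 := (c.1 %/ Q)%Z - (c'.1 %/ Q)%Z; pose w2 := (c.2 %/ Q)%Z - (c'.2 %/ Q)%Z.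
  have E1 : c.1 = c'.1 + 6 * (M%:Z * w1).
    by rewrite [LHS](eq_modz_shift e1) -/w1 /Q PoszM -mulrA.
  have E2 : c.2 = c'.2 + 6 * (M%:Z * w2).
    by rewrite [LHS](eq_modz_shift e2) -/w2 /Q PoszM -mulrA.
  have B : block_of c = ((block_of c').1 + scale b k * (q%:Z * w1),
                         (block_of c').2 + scale b k * (q%:Z * w2)).
    rewrite /b nscaleE /block_of /= E1 E2 /M PoszM; congr pair; apply: divz_uniq => //.
      by have := divz_bounds c'.1 (isT : 0 < 6 :> int); lia.
    by have := divz_bounds c'.2 (isT : 0 < 6 :> int); lia.
  have := nS _ cS; have := nS _ cS'; rewrite B anc_shift// /close2 /close /=.
  (* Cells equal modulo the period have ancestors differing by multiples of [q >= 5], whereas both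
     ancestors are within [2] of [U]. *)
  move=> n1 n2; have w10 : w1 = 0 by clear -n1 n2 q5; nia.
  have w20 : w2 = 0 by clear -n1 n2 q5; nia.
  rewrite [c]surjective_pairing [c']surjective_pairing E1 E2 w10 w20.
  by rewrite !mulr0 !addr0.
- move=> S _ x /mapP[c _ ->]; rewrite -!ltz_nat !redE.
  by rewrite !ltz_pmod.
- move=> s bs _ nG; have [U bU] : exists U, bad (bad_block (side R n) s k q bn) b k U.
    by apply: contrapT => no; apply: nG => U bU; apply: no; exists U.
  have [|U' U'q bU'] := bad_in_fundamental_domain _ bU; first by lia.
  have [S Sw Se] := bad_witness b_ge (fun z h => h) bU'.
  have SW : S \in W by apply/flatten_mapP; exists U'.
  rewrite (big_rem S)//= mul1r.
  have -> : occ (side R n) Q (map red S) s = 0%N.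
    rewrite occ_card; apply: eq_card0 => v; rewrite !inE; apply/negP => /mapP[c cS [h1 h2]].
    apply: (Se c cS v); exists (- (c.1 %/ Q)%Z), (- (c.2 %/ Q)%Z).
    have := redE c; rewrite /red -h1 -h2 /= => -[r1 r2].
    have := divz_eq c.1 Q; have := divz_eq c.2 Q.
    by rewrite -/M -/Q r1 r2; lia.
  by rewrite expr0 lerDl sumr_ge0// => t _; rewrite mul1r exprn_ge0.
rewrite leeD2l// lee_fin.
apply: (@le_trans _ _ (\sum_(t <- W) expR (- (n%:R / Q%:R ^+ 2 * (2 ^ k)%:R)))).
  rewrite big_seq [leRHS]big_seq; apply: ler_sum => S /WP[U /(witnessP b_ge)[sS _ _]].
  by rewrite mul1r size_map sS sub0r mulrN1 mulrN.
rewrite big_const_seq count_predT iter_addr_0 -[leLHS]mulr_natl ler_wpM2r ?expR_ge0//.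
by rewrite ler_nat.
Qed.

Definition count_event n q (m : R) s :=
  forall i j : nat, (occ (side R n) q [:: (i, j)] s)%:R <= m.

(** A Chernoff bound with [u = e] in each cell, using [e - 1 <= 3]. As [m >= 0], a violating cell is
    occupied and so is one of the [q x q] cells. *)
Lemma ppp_prob_count n q (m : R) G : (0 < n)%N -> (0 < q)%N -> 0 <= m ->
  (ppp_prob n G <= ppp_prob n (fun s => G s /\ count_event n q m s) +
   ((q * q)%:R * expR (3 * (n%:R / q%:R ^+ 2) - m))%:E)%E.
Proof.
move=> n0 q0 m0; pose r := [seq (i, j) | i <- iota 0 q, j <- iota 0 q].
have rP t : t \in r -> (t.1 < q)%N && (t.2 < q)%N.
  by case/allpairsP => -[i j] /= [hi hj ->]; move: hi hj; rewrite !mem_iota /=; lia.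
apply: le_trans (@ppp_prob_tilt_bound R n _ r q (fun t => [:: t]) (fun=> expR (- m))
   (expR 1) G (fun s => G s /\ count_event n q m s) n0 q0 _ _ _ _ _) _ => //.
- by move=> t tr x; rewrite inE => /eqP ->; exact: rP.
- move=> s bs Gs nE; have [i [j hij]] : exists i j, m < (occ (side R n) q [:: (i, j)] s)%:R.
    apply: contrapT => no; apply: nE; split=> // i j; rewrite leNgt; apply/negP => h.
    by apply: no; exists i, j.
  have ir : (i, j) \in r.
    have : (0 < occ (side R n) q [:: (i, j)] s)%N by rewrite -(ltr_nat R); exact: le_lt_trans m0 hij.
    rewrite /occ -has_count => /hasP[p ps]; rewrite inE => /eqP[<- <-].
    have [b1 b2] := bs _ ps.
    apply/allpairsP; exists (cell (side R n) q p.1, cell (side R n) q p.2).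
    by rewrite !mem_iota /= !add0n !cell_lt// side_gt0.
  rewrite (big_rem (i, j))//=.
  have h : 1 <= expR (- m) * expR 1 ^+ occ (side R n) q [:: (i, j)] s.
    rewrite -expRM_natl mulr1 -expRD; apply: le_trans (expR_ge1Dx _).
    by move: hij; lra.
  apply: le_trans h _; rewrite lerDl; apply: sumr_ge0 => t _.
  by apply: mulr_ge0; [|apply: exprn_ge0]; exact: expR_ge0.
rewrite leeD2l// lee_fin /= big_const_seq count_predT iter_addr_0 size_allpairs !size_iota.
rewrite -[leLHS]mulr_natl ler_wpM2l// -expRD ler_expR addrC lerD2r mul1r mulrC.
by rewrite ler_wpM2r ?divr_ge0 ?sqr_ge0//; have := expR1_le4 R; lra.
Qed.

(** The cores make up at least half of the blocks, so the component of [v0] is large. Any other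
    component lies in [9] coarse cells with at most [eta * n] points each, hence is smaller, which
    identifies the giant. *)
Lemma supercritical_event n k q (r eta eps delta : R) s : (0 < n)%N -> (5 <= q)%N ->
  0 <= eta -> in_box (side R n) s ->
  3 * (side R n / (6 * (q * nscale bn k))%:R) <= r ->
  r * (q * nscale bn k)%:R / side R n <= 1 ->
  9 * eta < delta -> 9 * eta <= eps ->
  2 * (delta * n%:R) <= (q * nscale bn k)%:R ^+ 2 ->
  good_event n k q s -> count_event n q (eta * n%:R) s ->
  delta * n%:R <= #|giant (side R n) r s|%:R /\
  forall i, i \notin giant (side R n) r s ->
            #|Defs.comp (side R n) r i|%:R <= eps * n%:R.
Proof.
move=> n0 q5 eta0 bs rlo rhi hd he hM good cnt.
have L0 := @side_gt0 R n n0.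
have q0 : (0 < q)%N by lia.
have n0' : 0 < n%:R :> R by rewrite ltr0n.
have [v0 [big small]] := renormalized_giant L0 bs bn_ge q5 rlo rhi good.
have v0_big : delta * n%:R <= #|Defs.comp (side R n) r v0|%:R.
  have : ((q * nscale bn k) ^ 2 <= 2 * #|Defs.comp (side R n) r v0|)%N.
    have := core_density_ge k; move: big; rewrite expnMn -mulnn -/b.
    set D := core_density _ k; set N := #|_|; set P := nscale bn k => h1 h2.
    apply: leq_trans (_ : _ <= q * q * (2 * D))%N _; first by rewrite leq_mul2l -mulnn mulnn h2 orbT.
    by rewrite mulnCA leq_mul2l h1 orbT.
  by rewrite -(ler_nat R) natrM natrX => h; move: hM h; lra.
have other v : v \notin Defs.comp (side R n) r v0 ->
    #|Defs.comp (side R n) r v|%:R <= 9 * eta * n%:R.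
  move=> nv; set c1 := cell (side R n) q (pos v).1; set c2 := cell (side R n) q (pos v).2.
  have [b1 b2] : box (side R n) (pos v).1 /\ box (side R n) (pos v).2.
    by apply: bs; rewrite mem_nth.
  have lc1 : (c1 < q)%N by exact: cell_lt.
  have lc2 : (c2 < q)%N by exact: cell_lt.
  pose nb c (d : 'I_3) := ((c + d + q).-1 %% q)%N.
  have le1 : (#|Defs.comp (side R n) r v| <=
     \sum_(d1 < 3) \sum_(d2 < 3) occ (side R n) q [:: (nb c1 d1, nb c2 d2)] s)%N.
    rewrite -sum1_card.
    have -> : (\sum_(d1 < 3) \sum_(d2 < 3) occ (side R n) q [:: (nb c1 d1, nb c2 d2)] s =
       \sum_(v' : 'I_(size s)) \sum_(d1 < 3) \sum_(d2 < 3)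
         ((cell (side R n) q (pos v').1, cell (side R n) q (pos v').2) ==
           (nb c1 d1, nb c2 d2)))%N.
      rewrite [RHS]exchange_big /=; apply: eq_bigr => d1 _.
      rewrite [RHS]exchange_big /=; apply: eq_bigr => d2 _.
      rewrite occ_card -sum1_card big_mkcond /=; apply: eq_bigr => v' _.
      by rewrite !inE; case: eqP.
    rewrite [leqRHS](bigID (mem (Defs.comp (side R n) r v))) /=.
    apply: leq_trans (leq_addr _ _); apply: leq_sum => v' vv'.
    have [w1 [w2 [h1 h2]]] := small v nv v' vv'.
    have [b1' b2'] : box (side R n) (pos v').1 /\ box (side R n) (pos v').2.
      by apply: bs; rewrite mem_nth.
    have l1 := cell_lt L0 q0 b1'; have l2 := cell_lt L0 q0 b2'.
    have [d1 e1] := close1_mod lc1 l1 h1; have [d2 e2] := close1_mod lc2 l2 h2.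
    rewrite (bigD1 d1)//= (bigD1 d2)//= /nb -e1 -e2 eqxx.
    exact: leq_trans (leq_addr _ _) (leq_addr _ _).
  apply: (@le_trans _ _ (\sum_(d1 < 3) \sum_(d2 < 3) (eta * n%:R))).
    move: le1; rewrite -(ler_nat R) => /le_trans; apply.
    rewrite natr_sum; apply: ler_sum => d1 _; rewrite natr_sum; apply: ler_sum => d2 _.
    exact: cnt.
  by rewrite !big_ord_recl !big_ord0; lra.
have [i [gE gmax]] := giantP (side R n) r v0.
have gv0 : giant (side R n) r s = Defs.comp (side R n) r v0.
  rewrite gE; have [iv0|/other] := boolP (i \in Defs.comp (side R n) r v0).
    by apply/esym/comp_eq; move: iv0; rewrite inE.
  rewrite -gE => h; have := gmax v0; rewrite -(ler_nat R) => h'.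
  have : 9 * eta * n%:R < delta * n%:R by rewrite ltr_pM2r.
  by move=> h3; exfalso; move: h h' v0_big h3; lra.
split; first by rewrite gv0.
move=> j; rewrite gv0 => /other h; apply: le_trans h _.
by rewrite ler_pM2r.
Qed.

End Supercritical.

(** * The giant regime at all large radii *)

Section GiantRegime.
Variable R : realType.

Lemma expRN_le_inv (x : R) : 0 < x -> expR (- x) <= x^-1.
Proof.
move=> x0; rewrite expRN lef_pV2 ?posrE ?expR_gt0//.
by apply: le_trans (expR_ge1Dx x); rewrite lerDr.
Qed.

Lemma expRN_le_inv_sqr (x : R) : 0 < x -> expR (- x) <= 4 / x ^+ 2.
Proof.
move=> x0; have := expR_ge_sqr (ltW x0) => h.
rewrite expRN -[4 / _]invrK lef_pV2 ?posrE ?expR_gt0//; last first.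
  by rewrite invr_gt0 divr_gt0// exprn_gt0.
by apply: le_trans h; rewrite invf_div.
Qed.

(** As [A * exp (- x) <= 1 / 4], the left side is at most [n * 4 ^ (- 2 ^ k)], and
    [4 ^ (2 ^ k) >= n ^ 2]. *)
Lemma peierls_bound (A n k q : nat) (W x : R) : (0 < n)%N ->
  0 <= W -> W <= A%:R ^+ (2 ^ k) -> 4 * (A.+1)%:R <= x ->
  (q * q <= n)%N -> (n < 2 ^ (2 ^ k))%N ->
  (q * q)%:R * (W * expR (- (x * (2 ^ k)%:R))) <= n%:R^-1.
Proof.
move=> n0 W0 WA hx qn nk; have A0 : 0 < 4 * (A.+1)%:R :> R by rewrite mulr_gt0// ltr0n.
have x0 : 0 < x := lt_le_trans A0 hx.
have n0' : 0 < n%:R :> R by rewrite ltr0n.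
set T := (2 ^ k)%N in WA nk *.
have hA : A%:R * expR (- x) <= 4^-1.
  apply: (@le_trans _ _ (A%:R * (4 * (A.+1)%:R)^-1)).
    rewrite ler_wpM2l// (le_trans (expRN_le_inv x0))// lef_pV2 ?posrE//.
  rewrite invfM mulrCA ler_piMr// ler_pdivrMr ?ltr0n// mul1r ler_nat//.
have h1 : W * expR (- (x * T%:R)) <= (4^-1) ^+ T.
  have -> : expR (- (x * T%:R)) = expR (- x) ^+ T by rewrite -expRM_natl mulrN mulrC.
  apply: (@le_trans _ _ (A%:R ^+ T * expR (- x) ^+ T)).
    by rewrite ler_wpM2r// exprn_ge0// expR_ge0.
  rewrite -exprMn; apply: lerXn2r => //; rewrite nnegrE; last by lra.
  by rewrite mulr_ge0// expR_ge0.
have h0 : 0 <= (4^-1) ^+ T :> R by rewrite exprn_ge0//; lra.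
apply: (@le_trans _ _ (n%:R * (4^-1) ^+ T)).
  apply: ler_pM => //; first by rewrite mulr_ge0// expR_ge0.
  by rewrite ler_nat.
have -> : (4^-1) ^+ T = ((2 ^ T)%:R ^+ 2)^-1 :> R.
  by rewrite exprVn natrX -exprM mulnC exprM; congr ((_ ^+ _)^-1); rewrite expr2; lra.
rewrite -[leRHS]mulr1 -[leRHS]mulrC -ler_pdivrMr ?invr_gt0// invrK mulrAC.
rewrite ler_pdivrMr ?exprn_gt0 ?ltr0n ?expn_gt0// mul1r -expr2.
by apply: lerXn2r; rewrite ?nnegrE// ler_nat ltnW.
Qed.

Lemma giant_regime_large : exists r0 : R, 0 < r0 /\
  forall r, r0 <= r -> giant_regime r.
Proof.
(* A fine cell has area at least [r ^ 2 / 36], which for [r >= 12 * (A + 1)] is at least the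
   [4 * (A + 1)] required by [peierls_bound]. *)
have [A hA] := witness_count_le; exists (12 * (A.+1)%:R); split.
  by rewrite mulr_gt0// ltr0n.
move=> r hr; have A1 : 1 <= (A.+1)%:R :> R by rewrite ler1n.
have r1 : 1 <= r by lra.
have r0 : 0 < r by lra.
(* Blocks will have side at most [2 * r], so there are at least [n / (4 * r ^ 2)] of them, more than
   [2 * delta * n]. *)
pose delta : R := (16 * r ^+ 2)^-1.
have delta0 : 0 < delta by rewrite invr_gt0 mulr_gt0// exprn_gt0.
exists delta; split=> // eps eps0.
pose eta : R := Num.min eps delta / 10.
have m0 : 0 < Num.min eps delta by rewrite lt_min eps0.
have eta0 : 0 < eta by rewrite /eta; lra.
have etae : 9 * eta <= eps.
  by have : Num.min eps delta <= eps; [rewrite ge_min lexx|rewrite /eta; lra].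
have etad : 9 * eta < delta.
  by have : Num.min eps delta <= delta; [rewrite ge_min lexx orbT|rewrite /eta; lra].
(* [K] makes [y], whose integer part is [q], at least [6 / eta + 6]. Hence [q >= 5], and a coarse
   cell has at most [eta * n / 6] points on average. *)
pose K := (Num.truncn (r * (6 / eta + 6))).+1.
have [N hN] := scale_choice K.
apply: (@cvg_squeeze_one R (fun=> 1%E) _ (1 + 16 / eta ^+ 2) (maxn N 1)).
- exact: cvg_cst.
- by move=> n; rewrite geq_max => /andP[_ n0]; exact: ppp_prob_le1.
move=> n; rewrite geq_max => /andP[nN n0].
have [k /andP[kP nk]] := hN n nN.
have L0 := @side_gt0 R n n0; set L := side R n in L0.
have n0' : 0 < n%:R :> R by rewrite ltr0n.
have n1 : 1 <= n%:R :> R by rewrite ler1n.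
have P0 : (0 < nscale bn k)%N by apply: nscale_gt0; exact: bn_ge.
set P := nscale bn k in kP P0.
have P0' : 0 < P%:R :> R by rewrite ltr0n.
have P1 : 1 <= P%:R :> R by rewrite ler1n.
have hK : r * (6 / eta + 6) <= K%:R by exact/ltW/truncnS_gt.
have KL : K%:R * P%:R <= L.
  rewrite -(@ler_pXn2r _ 2)// ?nnegrE ?mulr_ge0// ?(ltW L0)// side_sqr.
  by rewrite -natrM -natrX ler_nat.
pose y := L / (r * P%:R).
have rP0 : 0 < r * P%:R by rewrite mulr_gt0.
have y_ge : 6 / eta + 6 <= y.
  rewrite /y ler_pdivlMr//; apply: le_trans KL.
  by rewrite mulrA [_ * r]mulrC ler_wpM2r// ltW.
have e60 : 0 < 6 / eta by rewrite divr_gt0.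
have y0 : 0 <= y by lra.
pose q := Num.truncn y.
have /andP[qy yq] := truncn_itv y0; rewrite -/q -[q.+1]addn1 natrD in qy yq.
have q5 : (5 <= q)%N by rewrite -(ler_nat R); lra.
have q0 : (0 < q)%N by exact: leq_trans q5.
have q0' : 0 < q%:R :> R by rewrite ltr0n.
have qe : 6 / eta <= q%:R by lra.
set M := (q * P)%N.
have ME : M%:R = q%:R * P%:R :> R by rewrite natrM.
have M0 : 0 < M%:R :> R by rewrite ME mulr_gt0.
have rML : r * M%:R <= L.
  by move: qy; rewrite /y ler_pdivlMr// ME; lra.
have LrM : L <= 2 * r * M%:R.
  have q5' : 5 <= q%:R :> R by rewrite ler_nat.
  have : y <= 2 * q%:R by lra.
  rewrite /y ler_pdivrMr// ME; lra.
have qn : (q * q <= n)%N.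
  rewrite -(ler_nat R) -(side_sqr R n) expr2 natrM; apply: ler_pM => //.
  - by apply: le_trans rML; rewrite ME; nra.
  - by apply: le_trans rML; rewrite ME; nra.
rewrite -(@ppp_prob_true R n n0).
have s1 := @ppp_prob_good R n k q n0 q5.
have s2 := @ppp_prob_count R n q (eta * n%:R) (good_event n k q) n0 q0
   (mulr_ge0 (ltW eta0) (ltW n0')).
apply: le_trans s1 _; rewrite mulrDl EFinD mul1r [(_%:E + _)%E]addeC addeA.
apply: leeD; last first.
  rewrite lee_fin -/P -/M natrM -mulrA; apply: (peierls_bound (A := A)) => //.
    by rewrite -natrX ler_nat; exact: hA.
  apply: (@le_trans _ _ (r ^+ 2 / 36)).
    rewrite ler_pdivlMr//.
    have : (12 * (A.+1)%:R) ^+ 2 <= r ^+ 2 by rewrite ler_pXn2r ?nnegrE ?mulr_ge0// ltW.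
    by apply: le_trans; nra.
  rewrite natrM exprMn ler_pdivrMr// -(side_sqr R n) -/L.
  have -> : L ^+ 2 / (6%:R ^+ 2 * M%:R ^+ 2) * 36 = L ^+ 2 / M%:R ^+ 2.
    by field; rewrite gt_eqF.
  rewrite ler_pdivlMr ?exprn_gt0// -exprMn ler_pXn2r ?nnegrE ?mulr_ge0 ?(ltW L0)//; exact: ltW.
apply: le_trans s2 _; apply: leeD; last first.
  rewrite lee_fin; have hq : 3 * (n%:R / q%:R ^+ 2) - eta * n%:R <= - (eta * n%:R / 2).
    have : 3 * (n%:R / q%:R ^+ 2) <= eta * n%:R / 2.
      rewrite mulrA ler_pdivrMr ?exprn_gt0//.
      have h6 : 6 <= eta * q%:R by move: qe; rewrite ler_pdivrMr// mulrC.
      have q2 : q%:R <= q%:R ^+ 2 :> R by rewrite expr2 ler_peMl// ?ler1n// ltW.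
      have h7 : 6 <= eta * q%:R ^+ 2 by apply: le_trans h6 _; rewrite ler_pM2l.
      have : 6 * n%:R <= eta * q%:R ^+ 2 * n%:R by rewrite ler_pM2r.
      by lra.
    lra.
  apply: (@le_trans _ _ (n%:R * expR (- (eta * n%:R / 2)))).
    by apply: ler_pM => //; rewrite ?expR_ge0 ?ler_nat ?ler_expR.
  have en0 : 0 < eta * n%:R / 2 by rewrite divr_gt0// mulr_gt0.
  apply: (@le_trans _ _ (n%:R * (4 / (eta * n%:R / 2) ^+ 2))).
    by rewrite ler_wpM2l// expRN_le_inv_sqr.
  rewrite le_eqVlt; apply/orP; left; apply/eqP; field.
  by rewrite !gt_eqF.
apply: ppp_prob_mono => s bs [good cnt].
apply: (supercritical_event (k := k) (q := q) (eta := eta)) => //.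
- exact: ltW.
- rewrite -/P -/M -/L natrM; have -> : 3 * (L / (6%:R * M%:R)) = L / M%:R / 2 by field; rewrite gt_eqF.
  by rewrite ler_pdivrMr// ler_pdivrMr//; lra.
- by rewrite -/P -/M -/L ler_pdivrMr// mul1r.
- rewrite -/P -/M /delta -(side_sqr R n) -/L.
  have -> : 2 * ((16 * r ^+ 2)^-1 * L ^+ 2) = L ^+ 2 / (8 * r ^+ 2) by field; rewrite gt_eqF.
  rewrite ler_pdivrMr ?mulr_gt0 ?exprn_gt0//.
  have : L ^+ 2 <= (2 * r * M%:R) ^+ 2.
    by rewrite ler_pXn2r ?nnegrE ?mulr_ge0 ?(ltW L0) ?(ltW r0).
  have : 0 <= (r * M%:R) ^+ 2 by exact: sqr_ge0.
  rewrite !exprMn; set a := r ^+ 2; set c := M%:R ^+ 2; nra.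
Qed.

End GiantRegime.

(** * Degrees and diameter *)

Section Windows.
Implicit Types (M m : nat) (c : nat * nat).

(** Filtering the list of all residues modulo [M] counts each cell once, even when the window wraps
    around the torus. *)
Definition window1 M m (x0 : nat) : seq nat :=
  [seq x <- iota 0 M | `[< exists w : int, close m%:Z x%:Z (x0%:Z + w * M%:Z) >]].

Definition window M m c : seq (nat * nat) :=
  [seq (x, y) | x <- window1 M m c.1, y <- window1 M m c.2].

Lemma mem_window1 M m x0 x : (x \in window1 M m x0) <->
  (x < M)%N /\ exists w : int, close m%:Z x%:Z (x0%:Z + w * M%:Z).
Proof.
rewrite mem_filter mem_iota add0n leq0n /=; split.
  by case/andP => /asboolP h xM; split.
by case=> xM h; rewrite xM andbT; exact/asboolP.
Qed.

Lemma mem_window M m c c' : (c' \in window M m c) =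
  (c'.1 \in window1 M m c.1) && (c'.2 \in window1 M m c.2).
Proof.
apply/allpairsP/andP => [[[x y] /= [h1 h2 ->]]|[h1 h2]]; first by split.
by exists c'; split=> //; exact: surjective_pairing.
Qed.

Lemma window_uniq M m c : uniq (window M m c).
Proof.
by apply: allpairs_uniq; rewrite /window1 ?filter_uniq ?iota_uniq// => -[x y] [x' y'] _ _.
Qed.

Lemma size_window1 M m x0 : (size (window1 M m x0) <= 2 * m + 1)%N.
Proof.
pose f (e : nat) : nat := absz ((x0%:Z + e%:Z - m%:Z) %% M)%Z.
rewrite -[leqRHS](size_iota 0) -[leqRHS](size_map f); apply: uniq_leq_size.
  by rewrite /window1 filter_uniq// iota_uniq.
move=> x /mem_window1[xM [w [h1 h2]]]; apply/mapP.
exists (absz (x%:Z - (x0%:Z + w * M%:Z) + m%:Z)%R); first by rewrite mem_iota; lia.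
rewrite /f gez0_abs; last by lia.
have -> : x0%:Z + (x%:Z - (x0%:Z + w * M%:Z) + m%:Z) - m%:Z = (- w) * M%:Z + x%:Z by ring.
by rewrite modzMDl modz_small// ltz_nat.
Qed.

Lemma size_window M m c : (size (window M m c) <= (2 * m + 1) ^ 2)%N.
Proof. by rewrite size_allpairs -mulnn leq_mul// size_window1. Qed.

Lemma window_range M m c c' : c' \in window M m c -> (c'.1 < M)%N && (c'.2 < M)%N.
Proof. by rewrite mem_window => /andP[/mem_window1[-> _] /mem_window1[-> _]]. Qed.

Lemma window1_sym M m x y : (x < M)%N -> (y < M)%N ->
  x \in window1 M m y -> y \in window1 M m x.
Proof.
move=> xM yM /mem_window1[_ [w [h1 h2]]]; apply/mem_window1; split=> //.
by exists (- w); rewrite /close; lia.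
Qed.

Lemma window1_full M x y : (x < M)%N -> (y < M)%N -> x \in window1 M M y.
Proof.
by move=> xM yM; apply/mem_window1; split=> //; exists 0; rewrite /close; lia.
Qed.

Lemma window1_trans M m m' x y z : x \in window1 M m y -> z \in window1 M m' x ->
  z \in window1 M (m + m') y.
Proof.
move=> /mem_window1[_ [w [h1 h2]]] /mem_window1[zM [w' [h1' h2']]].
by apply/mem_window1; split=> //; exists (w + w'); rewrite /close; lia.
Qed.

Lemma window1_mono M m m' x y : (m <= m')%N ->
  x \in window1 M m y -> x \in window1 M m' y.
Proof.
move=> mm /mem_window1[xM [w [h1 h2]]]; apply/mem_window1; split=> //.
by exists w; rewrite /close; lia.
Qed.

Fixpoint subs (D : seq (nat * nat)) : seq (seq (nat * nat)) :=
  if D is c :: D' then subs D' ++ map (cons c) (subs D') else [:: [::]].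

Lemma subs_sub D S : S \in subs D -> {subset S <= D}.
Proof.
elim: D S => [|c D IH] S /=; first by rewrite inE => /eqP ->.
rewrite mem_cat => /orP[/IH h x /h xD|/mapP[S' /IH h ->] x].
  by rewrite inE xD orbT.
by rewrite !inE => /predU1P[->|/h ->]; rewrite ?eqxx ?orbT.
Qed.

Lemma subs_uniq D S : uniq D -> S \in subs D -> uniq S.
Proof.
elim: D S => [|c D IH] S /=; first by rewrite inE => _ /eqP ->.
case/andP => cD uD; rewrite mem_cat => /orP[/(IH _ uD)//|/mapP[S' S'D ->]] /=.
by rewrite (IH _ uD S'D) andbT; apply/negP => /(subs_sub S'D); exact/negP.
Qed.

Lemma sum_subs (R : realType) (x : R) D :
  \sum_(S <- subs D) x ^+ size S = (1 + x) ^+ size D.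
Proof.
elim: D => [|c D IH] /=; first by rewrite big_seq1.
rewrite big_cat big_map /= IH; under [X in _ + X]eq_bigr do rewrite exprS.
by rewrite -mulr_sumr IH exprS mulrDl mul1r.
Qed.

Section Occ.
Variables (R : realType) (L : R) (Q : nat) (s : seq (R * R)).

Lemma occ_cons c S : c \notin S ->
  occ L Q (c :: S) s = (occ L Q [:: c] s + occ L Q S s)%N.
Proof.
move=> cS; rewrite /occ; elim: s => [|p t IH] //=; rewrite IH !inE.
by case: eqP => [->|_] /=; rewrite ?(negbTE cS); lia.
Qed.

(** Expanding the product over subsets gives a sum of tilted functionals, the form required by
    [ppp_prob_tilt_bound]. *)
Lemma prod_subs (beta u : R) D : uniq D ->
  \prod_(c <- D) (1 + beta * u ^+ occ L Q [:: c] s) =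
  \sum_(S <- subs D) beta ^+ size S * u ^+ occ L Q S s.
Proof.
elim: D => [|c D IH] /=.
  rewrite big_nil big_seq1 /= mul1r /occ /=.
  by rewrite (eq_count (a2 := pred0)) ?count_pred0//.
case/andP=> cD uD; rewrite big_cons IH// big_cat big_map /= mulrDl mul1r; congr (_ + _).
rewrite mulr_sumr !big_seq; apply: eq_bigr => S SD.
rewrite (@occ_cons c S); last by apply: contra cD; apply: (subs_sub SD).
by rewrite exprS exprD; ring.
Qed.

Lemma sum_vertices_window (D : seq (nat * nat)) (f : nat * nat -> nat) : uniq D ->
  (\sum_(v < size s | (cell L Q (pos v).1, cell L Q (pos v).2) \in D)
     f (cell L Q (pos v).1, cell L Q (pos v).2) =
   \sum_(c <- D) occ L Q [:: c] s * f c)%N.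
Proof.
move=> uD.
have -> : (\sum_(c <- D) occ L Q [:: c] s * f c =
   \sum_(c <- D) \sum_(v < size s)
     (if (cell L Q (pos v).1, cell L Q (pos v).2) == c then f c else 0))%N.
  apply: eq_bigr => c _; rewrite occ_card -sum1_card big_distrl /= [LHS]big_mkcond /=.
  by apply: eq_bigr => v _; rewrite !inE; case: ifP => // _; rewrite mul1n.
rewrite exchange_big /= [LHS]big_mkcond /=; apply: eq_bigr => v _.
set x := (_, _); case: ifP => [xD|/negbT xD].
  rewrite (bigD1_seq x)//= eqxx big1 ?addn0// => c cx.
  by rewrite eq_sym (negbTE cx).
by rewrite big1_seq// => c /andP[_ cD]; case: eqP => // e; rewrite e cD in xD.
Qed.

End Occ.
End Windows.

(** * Sums of squared cell counts over windows *)

Section SquareSums.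
Variable R : realType.
Implicit Types (n M m : nat) (K : R) (s : seq (R * R)).

Definition window_event n M K s := forall x y m : nat, (x < M)%N -> (y < M)%N ->
  (m <= M)%N ->
  \sum_(c <- window M m (x, y)) (occ (side R n) M [:: c] s)%:R ^+ 2 <=
  K * (m.+1%:R ^+ 2 + ln (n%:R : R) ^+ 2).

(* For [N <= 1/theta], [theta N^2 <= N], so the quadratic exponential is
   dominated by an exponential of linear rate. *)
Lemma expR_sqr_le (theta : R) (N : nat) : 0 <= theta -> theta * N%:R <= 1 ->
  expR (theta * N%:R ^+ 2) <= 1 + 4 * theta * expR 2 ^+ N.
Proof.
move=> t0 tN; set y := theta * N%:R ^+ 2.
have N0 : 0 <= N%:R :> R by [].
have y0 : 0 <= y by rewrite mulr_ge0// sqr_ge0.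
have yN : y <= N%:R by rewrite /y expr2 mulrA; nra.
have h1 : expR y <= 1 + y * expR y.
  have := expR_ge1Dx (- y); rewrite expRN => h.
  have e0 := expR_gt0 y.
  have : (1 - y) * expR y <= 1 by rewrite -ler_pdivlMr// div1r.
  lra.
have h2 : y * expR y <= theta * (4 * expR N%:R) * expR N%:R.
  apply: ler_pM => //; rewrite ?expR_ge0// ?ler_expR//.
  by rewrite ler_wpM2l//; have := expR_ge_sqr N0; lra.
have -> : expR 2 ^+ N = expR N%:R * expR N%:R :> R.
  by rewrite -expRM_natl -expRD; congr expR; lra.
apply: le_trans h1 _; rewrite lerD2l; apply: le_trans h2 _; lra.
Qed.

(** A Chernoff bound at rate [theta = 1 / (2 * ln n)]: the count bound gives [theta * N_c <= 1], so
    [exp (theta * N_c ^ 2)] is at most [1 + 4 * theta * exp (2 * N_c)], and the product over a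
    window is expanded over its subsets. *)
Lemma ppp_prob_window n M K G : (0 < n)%N -> (0 < M)%N -> 1 <= ln (n%:R : R) ->
  8 <= K -> 16 * expR (n%:R / M%:R ^+ 2 * (expR 2 - 1)) <= K ->
  (ppp_prob n (fun s => G s /\ count_event n M (2 * ln n%:R) s) <=
   ppp_prob n (fun s => G s /\ window_event n M K s) +
   (2 * M%:R ^+ 4 / n%:R ^+ 4)%:E)%E.
Proof.
move=> n0 M0 l1 K8 hK; set l := ln n%:R in l1 *.
have n0' : 0 < n%:R :> R by rewrite ltr0n.
pose theta := (2 * l)^-1; have t0 : 0 < theta by rewrite invr_gt0; lra.
pose kappa := expR (n%:R / M%:R ^+ 2 * (expR 2 - 1)) : R.
pose thr (m : nat) := K * (m.+1%:R ^+ 2 + l ^+ 2).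
pose idx := [seq (m, c) | m <- iota 0 M.+1, c <- [seq (x, y) | x <- iota 0 M, y <- iota 0 M]].
pose r := [seq (mc.1, D) | mc <- idx, D <- subs (window M mc.1 mc.2)].
have rP t : t \in r -> exists2 c, t.2 \in subs (window M t.1 c) & True.
  by case/allpairsPdep => mc [S [_ hS ->]]; exists mc.2.
apply: le_trans (@ppp_prob_tilt_bound R n _ r M (fun t => t.2)
   (fun t => expR (- (theta * thr t.1)) * (4 * theta) ^+ size t.2) (expR 2) _
   (fun s => G s /\ window_event n M K s) n0 M0 _ _ _ _ _) _ => //.
- by move=> t; rewrite mulr_ge0 ?expR_ge0// exprn_ge0//; lra.
- by move=> t /rP[c h _]; exact: subs_uniq (window_uniq _ _ _) h.
- by move=> t /rP[c h _] x xt; exact: window_range (subs_sub h xt).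
- move=> s bs [Gs cnt] nE.
  have [x [y [m [xM yM mM hm]]]] : exists x y m, [/\ (x < M)%N, (y < M)%N, (m <= M)%N &
     thr m < \sum_(c <- window M m (x, y)) (occ (side R n) M [:: c] s)%:R ^+ 2].
    apply: contrapT => no; apply: nE; split=> // x y m xM yM mM.
    by rewrite leNgt; apply/negP => h; apply: no; exists x, y, m.
  set D := window M m (x, y) in hm.
  have mcI : (m, (x, y)) \in idx.
    apply/allpairsP; exists (m, (x, y)); split; last by [].
      by rewrite mem_iota.
    by apply/allpairsP; exists (x, y); rewrite !mem_iota.
  have terms_ge0 t : 0 <= expR (- (theta * thr t.1)) * (4 * theta) ^+ size t.2 *
      expR 2 ^+ occ (side R n) M t.2 s.
    by rewrite !mulr_ge0 ?expR_ge0 ?exprn_ge0 ?expR_ge0//; lra.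
  rewrite /r big_allpairs_dep (big_rem (m, (x, y)))//= -/D.
  apply: (@le_trans _ _ (\sum_(S <- subs D) expR (- (theta * thr m)) *
     (4 * theta) ^+ size S * expR 2 ^+ occ (side R n) M S s)); last first.
    by rewrite lerDl; apply: sumr_ge0 => mc _; apply: sumr_ge0 => S _; exact: (terms_ge0 (mc.1, S)).
  under eq_bigr do rewrite -mulrA.
  rewrite -mulr_sumr -prod_subs ?window_uniq//.
  apply: (@le_trans _ _ (expR (- (theta * thr m)) *
     \prod_(c <- D) expR (theta * (occ (side R n) M [:: c] s)%:R ^+ 2))).
    rewrite -expR_sum -mulr_sumr -expRD; apply: le_trans (expR_ge1Dx _).
    by rewrite lerDl addrC subr_ge0 ler_pM2l// ltW.
  rewrite ler_wpM2l ?expR_ge0//; apply: ler_prod => c _; rewrite expR_ge0 /=.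
  apply: expR_sqr_le; first exact: ltW.
  rewrite /theta mulrC ler_pdivrMr; last by lra.
  by rewrite mul1r; case: c => i j; exact: cnt.
rewrite leeD2l// lee_fin /r big_allpairs_dep.
apply: (@le_trans _ _ (\sum_(mc <- idx) expR (- (theta * thr mc.1)) *
   (1 + 4 * theta * kappa) ^+ size (window M mc.1 mc.2))).
  apply: ler_sum => mc _; rewrite -sum_subs mulr_sumr; apply: ler_sum => S _ /=.
  rewrite -mulrA ler_wpM2l ?expR_ge0// [in leRHS]exprMn ler_wpM2l//.
    by apply: exprn_ge0; lra.
  by rewrite /kappa -expRM_natl mulrCA.
have k0 : 0 < kappa by exact: expR_gt0.
(* The product contributes at most [exp (theta * 16 * kappa * (m + 1) ^ 2)], absorbed by
   [K >= 16 * kappa]; the term [K * l ^ 2] with [K >= 8] leaves [exp (- 4 * l) = n ^ (- 4)]. *)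
have each mc : expR (- (theta * thr mc.1)) *
   (1 + 4 * theta * kappa) ^+ size (window M mc.1 mc.2) <= (n%:R ^+ 4)^-1.
  have tk0 : 0 <= 4 * theta * kappa by rewrite !mulr_ge0//; lra.
  have h1 : (1 + 4 * theta * kappa) ^+ size (window M mc.1 mc.2) <=
      expR (theta * (16 * kappa * mc.1.+1%:R ^+ 2)).
    apply: (@le_trans _ _ ((1 + 4 * theta * kappa) ^+ (4 * mc.1.+1 ^ 2))).
      apply: ler_weXn2l; first by lra.
      by apply: leq_trans (size_window _ _ _) _; lia.
    have -> : theta * (16 * kappa * mc.1.+1%:R ^+ 2) =
       (4 * mc.1.+1 ^ 2)%:R * (4 * theta * kappa) by rewrite natrM natrX; ring.
    rewrite expRM_natl; apply: lerXn2r; rewrite ?nnegrE ?expR_ge0//; last exact: expR_ge1Dx.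
    by rewrite addr_ge0.
  apply: (@le_trans _ _ (expR (- (theta * thr mc.1)) * expR (theta * (16 * kappa * mc.1.+1%:R ^+ 2)))).
    by rewrite ler_wpM2l ?expR_ge0.
  have -> : (n%:R ^+ 4)^-1 = expR (- (4 * l)) :> R.
    by rewrite expRN expRM_natl lnK.
  rewrite -expRD ler_expR.
  have -> : - (4 * l) = - (theta * (8 * l ^+ 2)) by rewrite /theta; field; lra.
  rewrite /thr; set Z := 16 * kappa * _; set Y := K * _.
  have -> : - (theta * Y) + theta * Z = theta * (Z - Y) by ring.
  have -> : - (theta * (8 * l ^+ 2)) = theta * - (8 * l ^+ 2) by ring.
  rewrite ler_pM2l// /Z /Y.
  have m2 : 0 <= mc.1.+1%:R ^+ 2 :> R by exact: sqr_ge0.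
  have l2 : 0 <= l ^+ 2 by exact: sqr_ge0.
  have : 16 * kappa * mc.1.+1%:R ^+ 2 <= K * mc.1.+1%:R ^+ 2 by rewrite ler_wpM2r.
  have : 8 * l ^+ 2 <= K * l ^+ 2 by rewrite ler_wpM2r.
  lra.
apply: (@le_trans _ _ (\sum_(mc <- idx) (n%:R ^+ 4)^-1)); first exact: ler_sum.
rewrite big_const_seq count_predT iter_addr_0 -[leLHS]mulr_natl.
rewrite ler_wpM2r ?invr_ge0 ?exprn_ge0//.
(* There are [(M + 1) * M ^ 2 <= 2 * M ^ 4] pairs of a radius and a centre. *)
rewrite !size_allpairs !size_iota -natrX -natrM ler_nat.
by clear -M0; rewrite !expnS expn0; nia.
Qed.

End SquareSums.

(** * Degrees in terms of cell counts *)

Section Degrees.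
Variables (R : realType) (L r : R) (s : seq (R * R)) (M : nat).
Hypothesis L0 : 0 < L.
Hypothesis M0 : (0 < M)%N.
Hypothesis bs : in_box L s.
Hypothesis rM : r * M%:R / L <= 1.

Let key (v : 'I_(size s)) : nat * nat := (cell L M (pos v).1, cell L M (pos v).2).

Let pos_box (v : 'I_(size s)) : box L (pos v).1 /\ box L (pos v).2.
Proof. by apply: bs; rewrite /pos mem_nth. Qed.

Lemma degE (v : 'I_(size s)) : deg L r v = (\sum_(w < size s) adj L r v w)%N.
Proof.
rewrite /deg -sum1_card [RHS](bigID (fun w => adj L r v w)) /= [X in (_ + X)%N]big1.
  have E w : (w \in in_set [set j | adj L r v j]) = adj L r v w by exact: asboolb.
  by rewrite addn0; apply: eq_big => w; rewrite E// => ->.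
by move=> w /negbTE ->.
Qed.

Lemma close_window (v w : 'I_(size s)) (rho : R) (m : nat) :
  tdist L (pos v) (pos w) <= rho -> rho * M%:R / L <= m%:R ->
  key v \in window M m (key w).
Proof.
move=> d hm; have [b1 b2] := pos_box v; have [b1' b2'] := pos_box w.
have [t1 t2] := tcoord_le_tdist L (pos v) (pos w).
have [w1 c1] := cell_close L0 M0 b1 b1' (le_trans t1 d) hm.
have [w2 c2] := cell_close L0 M0 b2 b2' (le_trans t2 d) hm.
rewrite mem_window; apply/andP; split; apply/mem_window1; split=> /=.
- exact: cell_lt.
- by exists w1.
- exact: cell_lt.
- by exists w2.
Qed.

Lemma tdist_sym (p q : R * R) : tdist L p q = tdist L q p.
Proof. by rewrite /tdist /tcoord distrC [`|p.2 - _|]distrC. Qed.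

Let N (c : nat * nat) := occ L M [:: c] s.

Lemma count_window1 (W : seq (nat * nat)) c : uniq W ->
  (\sum_(c' <- W) (c' \in window M 1 c) <= 9)%N.
Proof.
move=> uW; apply: (@leq_trans (size (window M 1 c))); last exact: size_window.
rewrite -big_mkcond /= sum1_count -size_filter; apply: uniq_leq_size.
  by rewrite filter_uniq.
by move=> x; rewrite mem_filter => /andP[].
Qed.

(** Graph neighbours lie in adjacent cells, so [deg A] is at most the sum of [N c * N c'] over
    adjacent cells of the window. Then [N c * N c' <= N c ^ 2 + N c' ^ 2] and at most [9] cells are
    adjacent to a given one, itself included, hence [18 = 9 + 9]. A window of radius [M] already
    covers the torus. *)
Lemma degA_le (A : {set 'I_(size s)}) (u0 : 'I_(size s)) (m : nat) :
  (forall v, v \in A -> key v \in window M m (key u0)) ->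
  (degA L r A <= 18 * \sum_(c <- window M (minn m.+1 M) (key u0)) N c ^ 2)%N.
Proof.
move=> hA; set W := window M (minn m.+1 M) (key u0).
have uW : uniq W by exact: window_uniq.
have keyM v : ((key v).1 < M)%N && ((key v).2 < M)%N.
  by have [b1 b2] := pos_box v; rewrite /key /= !cell_lt.
have up (i : nat) v : (i <= m.+1)%N -> key v \in window M i (key u0) -> key v \in W.
  rewrite /W !mem_window => im /andP[h1 h2].
  have /andP[v1 v2] := keyM v; have /andP[x1 x2] := keyM u0.
  case: (leqP m.+1 M) => _; last by rewrite !window1_full.
  by rewrite (window1_mono im h1) (window1_mono im h2).
have step1 : (degA L r A <= \sum_(v < size s | key v \in W)
    \sum_(w < size s | key w \in W) (key w \in window M 1 (key v)))%N.
  rewrite /degA [leqRHS](bigID (mem A)) /=; apply: leq_trans (leq_addr _ _).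
  rewrite [leqRHS](eq_bigl (mem A)); last first.
    by move=> v /=; case vA: (v \in A); rewrite ?andbF// andbT (up m)// hA.
  apply: leq_sum => v vA; rewrite degE [leqRHS]big_mkcond; apply: leq_sum => w _.
  case avw: (adj L r v w) => //.
  have w1 : key w \in window M 1 (key v).
    move: avw => /andP[_]; rewrite tdist_sym => d; apply: close_window d _; exact: rM.
  rewrite w1 (up m.+1)//; move: (hA _ vA) w1; rewrite !mem_window -[m.+1]addn1.
  by move=> /andP[h1 h2] /andP[h3 h4]; rewrite (window1_trans h1 h3) (window1_trans h2 h4).
apply: leq_trans step1 _.
have -> : (\sum_(v < size s | key v \in W)
    \sum_(w < size s | key w \in W) (key w \in window M 1 (key v)) =
    \sum_(c <- W) \sum_(c' <- W) N c * (N c' * (c' \in window M 1 c)))%N.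
  rewrite (eq_bigr (fun v => \sum_(c' <- W) N c' * (c' \in window M 1 (key v)))%N); last first.
    by move=> v _; rewrite -(@sum_vertices_window R L M s W (fun c' => (c' \in window M 1 (key v)) : nat) uW).
  rewrite (@sum_vertices_window R L M s W (fun c => \sum_(c' <- W) N c' * (c' \in window M 1 c))%N uW).
  by apply: eq_bigr => c _; rewrite big_distrr.
apply: (@leq_trans (\sum_(c <- W) \sum_(c' <- W) (N c ^ 2 * (c' \in window M 1 c)) +
   \sum_(c <- W) \sum_(c' <- W) (N c' ^ 2 * (c \in window M 1 c')))).
  rewrite -big_split /= !big_seq; apply: leq_sum => c cW.
  rewrite -big_split /= !big_seq; apply: leq_sum => c' cW'.
  case h: (c' \in window M 1 c); last by rewrite !muln0.
  have -> : c \in window M 1 c'.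
    have /andP[x1 x2] := window_range cW; have /andP[y1 y2] := window_range cW'.
    move: h; rewrite !mem_window => /andP[h1 h2].
    by rewrite (window1_sym y1 x1 h1) (window1_sym y2 x2 h2).
  by rewrite !muln1; nia.
have bound9 : (\sum_(c <- W) \sum_(c' <- W) (N c ^ 2 * (c' \in window M 1 c)) <=
    9 * \sum_(c <- W) N c ^ 2)%N.
  rewrite big_distrr /=; apply: leq_sum => c _; rewrite -big_distrr /= mulnC leq_mul2r.
  by rewrite count_window1// orbT.
rewrite -[18%N]/(9 + 9)%N mulnDl leq_add// exchange_big /=; exact: bound9.
Qed.

(** In a component with at least two vertices every degree is at least one. *)
Lemma card_comp_le_degA (i : 'I_(size s)) : (2 <= #|Defs.comp L r i|)%N ->
  (#|Defs.comp L r i| <= degA L r (Defs.comp L r i))%N.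
Proof.
move=> c2; rewrite -sum1_card /degA; apply: leq_sum => v; rewrite inE => iv.
have [w wc wv] : exists2 w, w \in Defs.comp L r i & w != v.
  apply/exists_inP; move: c2; rewrite (cardD1 v) inE iv add1n ltnS.
  by move=> /card_gt0P[w]; rewrite inE => /andP[wv wc]; apply/exists_inP; exists w.
have : connect (adj L r (s := s)) v w.
  move: wc; rewrite inE; apply: connect_trans.
  by rewrite (sym_connect_sym (@adj_sym R L r s)).
case/connectP => -[|x p] /=; first by move=> _ e; rewrite e eqxx in wv.
by case/andP => avx _ _; rewrite degE (bigD1 x)//= avx leq_addr.
Qed.

End Degrees.

(** Transfers the size of the giant component from the fixed radius [rmin] to the radius [r n],
    which varies with [n]. *)
Lemma comp_mono (R : realType) (L r r' : R) (s : seq (R * R)) (i : 'I_(size s)) :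
  r <= r' -> (#|Defs.comp L r i| <= #|Defs.comp L r' i|)%N.
Proof.
move=> rr; apply/subset_leq_card/fintype.subsetP => j; rewrite !inE.
apply: connect_sub => x y /andP[xy d]; apply: connect1; rewrite /adj xy /=.
exact: le_trans d rr.
Qed.

(** * From window sums to the diameter *)

Section DiameterBound.
Variable R : realType.

(** The left side is the square of the distance [c * sqrt (deg A)] measured in cells;
    [M / L <= 1 / rmax] cancels [rmax], and [144 = 12 ^ 2]. *)
Lemma window_radius_sqr (rmax K d M L : R) : 0 < rmax -> 1 <= K -> 0 <= d ->
  0 <= M -> 0 < L -> rmax * M <= L ->
  (rmax / (12 * K) * Num.sqrt d * M / L) ^+ 2 <= d / (144 * K ^+ 2).
Proof.
move=> rmax0 K1 d0 M0 L0 rM; have K12 : 0 < 12 * K by lra.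
have sK : 0 <= Num.sqrt d / (12 * K) by rewrite divr_ge0 ?sqrtr_ge0// ltW.
have yle : rmax / (12 * K) * Num.sqrt d * M / L <= Num.sqrt d / (12 * K).
  rewrite ler_pdivrMr//.
  have -> : rmax / (12 * K) * Num.sqrt d * M = Num.sqrt d / (12 * K) * (rmax * M).
    by field; rewrite gt_eqF//; lra.
  by rewrite ler_wpM2l.
apply: (@le_trans _ _ ((Num.sqrt d / (12 * K)) ^+ 2)).
  apply: lerXn2r => //; rewrite nnegrE; apply: divr_ge0; last exact: ltW.
  by rewrite !mulr_ge0 ?sqrtr_ge0// ?invr_ge0 ltW.
rewrite expr_div_n sqr_sqrtr// exprMn le_eqVlt; apply/orP; left; apply/eqP.
by congr (_ / (_ * _)); rewrite expr2; lra.
Qed.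

(** As [t ^ 2 <= 2 * y ^ 2 + 18], the upper bound on [d] is at most
    [36 * K * y ^ 2 + 342 * K * l ^ 2], hence at most [d / 4 + (342 / 500) * d], which is less than
    [d]. *)
Lemma window_numeric (K K' l y d t : R) : 1 <= K -> 1 <= l -> 500 * K <= K' ->
  K' * l ^+ 2 <= d -> 0 <= y -> y ^+ 2 <= d / (144 * K ^+ 2) ->
  0 <= t -> t <= y + 3 -> d <= 18 * (K * (t ^+ 2 + l ^+ 2)) -> False.
Proof.
move=> K1 l1 KK' dA y0 hy t0 ty hd.
have l2 : 1 <= l ^+ 2 by rewrite expr2; nra.
have KKl : 500 * (K * l ^+ 2) <= K' * l ^+ 2 by rewrite mulrA ler_wpM2r//; lra.
have Kl : K <= K * l ^+ 2 by rewrite ler_peMr//; lra.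
have d0 : 0 <= d by lra.
have t2 : t ^+ 2 <= 2 * y ^+ 2 + 18.
  apply: (@le_trans _ _ ((y + 3) ^+ 2)); first by rewrite ler_pXn2r ?nnegrE//; lra.
  by have := sqr_ge0 (y - 3); rewrite !expr2; lra.
have Ky : 144 * (K * y ^+ 2) <= d.
  have h1 : K * y ^+ 2 <= K * (d / (144 * K ^+ 2)) by rewrite ler_wpM2l//; lra.
  have e1 : K * (d / (144 * K ^+ 2)) = d / 144 / K by field; rewrite gt_eqF//; lra.
  have h2 : d / 144 / K <= d / 144.
    by rewrite ler_pdivrMr; [rewrite ler_peMr// divr_ge0|lra].
  by move: h1 h2; rewrite e1; lra.
have : K * t ^+ 2 <= K * (2 * y ^+ 2 + 18) by rewrite ler_wpM2l//; lra.
by move: hd; rewrite !mulrDr; lra.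
Qed.

(** The giant component has degree at least [delta * n], so the hypothesis on [piA] gives
    [deg A >= K' * (ln n) ^ 2]. If [A] stayed within [rho] of one of its vertices, the window sum
    around it would bound [deg A] by less than itself. *)
Lemma diam_event_of_windows (n M : nat) (r rmin rmax K K' delta : R) s :
  (0 < n)%N -> (0 < M)%N -> in_box (side R n) s -> 0 < rmax ->
  rmin <= r <= rmax -> rmax * M%:R <= side R n -> 1 <= ln (n%:R : R) ->
  1 <= K -> 500 * K <= K' -> 0 < delta -> 2 <= delta * n%:R ->
  delta * n%:R <= #|giant (side R n) rmin s|%:R -> window_event n M K s ->
  diam_event n r (K' / delta) (rmax / (12 * K)) s.
Proof.
move=> n0 M0 bs rmax0 /andP[rlo rhi] rM l1 K1 KK' d0 d2 gmin ev A Asub piA_ge.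
set L := side R n in bs rM gmin piA_ge Asub *.
have L0 : 0 < L by exact: side_gt0.
have n0' : 0 < n%:R :> R by rewrite ltr0n.
have M0' : 0 < M%:R :> R by rewrite ltr0n.
set l := ln n%:R in l1 piA_ge.
have rML : r * M%:R / L <= 1.
  by rewrite ler_pdivrMr// mul1r; apply: le_trans rM; rewrite ler_pM2r.
have [v0 _] : exists v0 : 'I_(size s), v0 \in giant L rmin s.
  apply/card_gt0P; rewrite -(ltr_nat R); lra.
have gbig : delta * n%:R <= #|giant L r s|%:R.
  have [i [gE _]] := giantP L rmin v0; have [j [_ gmax]] := giantP L r v0.
  apply: le_trans gmin _; rewrite ler_nat gE.
  exact: leq_trans (comp_mono L i rlo) (gmax i).
have gdeg : delta * n%:R <= (degA L r (giant L r s))%:R.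
  have gbig2 := le_trans d2 gbig.
  apply: (le_trans gbig); have [i [gE _]] := giantP L r v0.
  rewrite ler_nat gE; apply: card_comp_le_degA; rewrite -gE -(ler_nat R).
  exact: gbig2.
have dn0 : 0 < delta * n%:R by rewrite mulr_gt0.
set d := (degA L r A)%:R : R.
have dA : K' * l ^+ 2 <= d.
  move: piA_ge; rewrite /piA -/d ler_pdivlMr; last exact: lt_le_trans gdeg.
  apply: le_trans.
  have Kl : 0 <= K' * l ^+ 2 by apply: mulr_ge0; [clear -KK' K1; lra|exact: sqr_ge0].
  have -> : K' / delta * l ^+ 2 / n%:R * (degA L r (giant L r s))%:R =
    K' * l ^+ 2 * ((degA L r (giant L r s))%:R / (delta * n%:R)).
    by field; rewrite !gt_eqF.
  by rewrite ler_peMr// ler_pdivlMr// mul1r.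
have K0 : 0 < K by exact: lt_le_trans K1.
have dpos : 0 < d.
  apply: lt_le_trans dA; apply: mulr_gt0; last by rewrite exprn_gt0// (lt_le_trans _ l1).
  by clear -KK' K1; lra.
have [u0 u0A] : exists u0, u0 \in A.
  apply/card_gt0P; rewrite lt0n; apply/negP => /eqP/cards0_eq A0.
  by move: dpos; rewrite /d /degA A0 big_set0 ltxx.
apply: contrapT => no.
set c := rmax / (12 * K) in no; set rho := c * Num.sqrt d in no.
have c0 : 0 < c by apply: divr_gt0 => //; rewrite mulr_gt0// ltr0n.
have rho0 : 0 <= rho by rewrite mulr_ge0 ?sqrtr_ge0// ltW.
have small v : v \in A -> tdist L (pos v) (pos u0) <= rho.
  move=> vA; rewrite leNgt; apply/negP => h; apply: no; exists v, u0.
  by split=> //; split=> //; exact: ltW.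
pose y := rho * M%:R / L.
have y0 : 0 <= y by apply: divr_ge0; [apply: mulr_ge0|exact: ltW].
pose m := (Num.truncn y).+1.
have /andP[ty yt] := truncn_itv y0.
have ym : y <= m%:R by exact: ltW.
have my : m%:R <= y + 1 by rewrite /m -addn1 natrD lerD2r.
have hA v : v \in A -> (cell L M (pos v).1, cell L M (pos v).2) \in
    window M m (cell L M (pos u0).1, cell L M (pos u0).2).
  by move=> vA; exact: (close_window L0 M0 bs (small v vA) ym).
have := degA_le L0 M0 bs rML hA; set W := window _ _ _ => hdeg.
have [b1 b2] : box L (pos u0).1 /\ box L (pos u0).2 by apply: bs; rewrite mem_nth.
have := ev (cell L M (pos u0).1) (cell L M (pos u0).2) (minn m.+1 M)
   (cell_lt L0 M0 b1) (cell_lt L0 M0 b2) (geq_minr _ _).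
rewrite -/L -/W -/l => hW.
have dW : d <= 18 * \sum_(c <- W) (occ L M [:: c] s)%:R ^+ 2.
  move: hdeg; rewrite -(ler_nat R) natrM natr_sum => h; apply: le_trans h _.
  by rewrite ler_wpM2l//; apply: ler_sum => x _; rewrite natrX.
(* The [3] collects the rounding up of [y], the extra ring of cells in [degA_le] and the successor
   in [window_event]. *)
have mm : (minn m.+1 M).+1%:R <= y + 3 :> R.
  apply: (@le_trans _ _ (m.+2)%:R); first by rewrite ler_nat ltnS geq_minl.
  by clear -my; rewrite -addn2 natrD; lra.
have hy : y ^+ 2 <= d / (144 * K ^+ 2).
  exact: (window_radius_sqr rmax0 K1 (ltW dpos) (ltW M0') L0 rM).
have mm0 : 0 <= (minn m.+1 M).+1%:R :> R by exact: ler0n.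
apply: (window_numeric K1 l1 KK' dA y0 hy mm0 mm).
apply: le_trans dW _; rewrite ler_wpM2l//; exact: hW.
Qed.

End DiameterBound.

(** * Choice of constants and assembly of the estimates *)

Theorem proposition5p1 (R : realType) (rmin rmax : R) (r : nat -> R) :
  r_g R < rmin -> rmin <= rmax ->
  (forall n, rmin <= r n <= rmax) ->
  exists C c : R, 0 < c /\
    (fun n : nat => ppp_prob n (diam_event n (r n) C c)) @ \oo --> 1%E.
Proof.
move=> rg_lt rmm hr.
have [r1 [r1_gt0 large]] := giant_regime_large R.
(* The radius [r1] makes the set defining [r_g] nonempty, so that set has an element below
   [rmin]. *)
have [r2 [r2_gt0 hr2] r2_lt] : exists2 x, (0 < x /\ forall r', x <= r' -> giant_regime r') & x < rmin.
  by apply: inf_lt rg_lt; exists r1.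
have [delta [d0 /(_ 1 ltr01) hG]] := hr2 rmin (ltW r2_lt).
have rmax0 : 0 < rmax by exact: lt_le_trans (lt_trans r2_gt0 r2_lt) rmm.
(* The cells chosen below have area [n / M ^ 2 <= 4 * rmax ^ 2]. *)
pose K : R := 8 + 16 * expR (4 * rmax ^+ 2 * (expR 2 - 1)).
have e0 := expR_gt0 (4 * rmax ^+ 2 * (expR 2 - 1) : R).
have K8 : 8 <= K by rewrite /K; lra.
have [K' KK'] : exists K', 500 * K <= K' by exists (500 * K).
exists (K' / delta), (rmax / (12 * K)); split; first by rewrite divr_gt0//; lra.
(* The two terms are [n] times bounds for the failure of [count_event] and of [window_event],
   obtained from [M ^ 2 <= n / rmax ^ 2]. *)
pose err : R := expR (12 * rmax ^+ 2) / rmax ^+ 2 + 2 / rmax ^+ 4.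
(* This ensures [rmax <= side R n], [n >= 4 >= e] so that [ln n >= 1], and [delta * n >= 2]. *)
pose n_min := (Num.truncn (rmax ^+ 2 + 4 + 2 / delta)).+1.
apply: (cvg_squeeze_one (K := err) (N := n_min) hG).
  by move=> n hn; apply: ppp_prob_le1; exact: leq_trans hn.
move=> n hn; have n0 : (0 < n)%N by exact: leq_trans hn.
have n0' : 0 < n%:R :> R by rewrite ltr0n.
have nge : rmax ^+ 2 + 4 + 2 / delta <= n%:R.
  by apply: le_trans (ltW (truncnS_gt _)) _; rewrite ler_nat.
have rmax2 : 0 < rmax ^+ 2 by rewrite exprn_gt0.
have d2 : 0 < 2 / delta by rewrite divr_gt0.
have n1 : 1 <= n%:R :> R by lra.
have dn2 : 2 <= delta * n%:R by rewrite mulrC -ler_pdivrMr//; lra.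
have l1 : 1 <= ln (n%:R : R).
  have e1n : expR 1 <= n%:R :> R by have := expR1_le4 R; lra.
  by rewrite -[leLHS]expRK ler_ln ?posrE ?expR_gt0.
have L0 := @side_gt0 R n n0.
have Lr : rmax <= side R n.
  by rewrite -(@ler_pXn2r _ 2)// ?nnegrE ?(ltW L0) ?(ltW rmax0)// side_sqr; lra.
pose y := side R n / rmax; have y1 : 1 <= y by rewrite /y ler_pdivlMr// mul1r.
have y0 : 0 <= y by lra.
(* Cells have side between [rmax] and [2 * rmax]: edges join adjacent cells, and the mean count of a
   cell is bounded. *)
have /andP[My yM] := truncn_itv y0; set M := Num.truncn y in My yM.
have M0 : (0 < M)%N by rewrite lt0n; apply/negP => /eqP Me; move: yM; rewrite Me; lra.
have M1 : 1 <= M%:R :> R by rewrite ler1n.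
have M0' : 0 < M%:R :> R by lra.
have rML : rmax * M%:R <= side R n by move: My; rewrite /y ler_pdivlMr// mulrC.
have LrM : side R n <= 2 * rmax * M%:R.
  have : y <= 2 * M%:R by move: yM; rewrite -addn1 natrD; lra.
  by rewrite /y ler_pdivrMr//; lra.
have a_le : n%:R / M%:R ^+ 2 <= 4 * rmax ^+ 2.
  rewrite ler_pdivrMr ?exprn_gt0// -(side_sqr R n).
  have -> : 4 * rmax ^+ 2 * M%:R ^+ 2 = (2 * rmax * M%:R) ^+ 2 by rewrite !exprMn; ring.
  by rewrite ler_pXn2r ?nnegrE ?mulr_ge0 ?(ltW L0) ?(ltW rmax0).
have M2 : M%:R ^+ 2 <= n%:R / rmax ^+ 2.
  rewrite ler_pdivlMr// -exprMn -(side_sqr R n).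
  by rewrite ler_pXn2r ?nnegrE ?mulr_ge0 ?(ltW L0) ?(ltW rmax0)// mulrC.
pose G (s : seq (R * R)) := delta * n%:R <= #|giant (side R n) rmin s|%:R /\
   forall i, i \notin giant (side R n) rmin s -> #|Defs.comp (side R n) rmin i|%:R <= 1 * n%:R :> R.
have l0 : 0 <= 2 * ln (n%:R : R) by lra.
have s1 := @ppp_prob_count R n M (2 * ln n%:R) G n0 M0 l0.
have hK : 16 * expR (n%:R / M%:R ^+ 2 * (expR 2 - 1)) <= K.
  have e2 : 0 <= expR 2 - 1 :> R by have := expR_ge1Dx (2 : R); lra.
  have : expR (n%:R / M%:R ^+ 2 * (expR 2 - 1)) <= expR (4 * rmax ^+ 2 * (expR 2 - 1)) :> R.
    by rewrite ler_expR ler_wpM2r.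
  rewrite /K; lra.
have s2 := @ppp_prob_window R n M K G n0 M0 l1 K8 hK.
have -> : err / n%:R = 2 / rmax ^+ 4 / n%:R + expR (12 * rmax ^+ 2) / rmax ^+ 2 / n%:R.
  by rewrite /err addrC mulrDl.
apply: le_trans s1 _; rewrite EFinD addeA; apply: leeD; last first.
  rewrite lee_fin expRD expRN expRM_natl lnK ?posrE// natrM -expr2.
  apply: (@le_trans _ _ (n%:R / rmax ^+ 2 * (expR (12 * rmax ^+ 2) / n%:R ^+ 2))).
    apply: ler_pM => //.
    by rewrite ler_wpM2r ?invr_ge0 ?exprn_ge0// ler_expR; lra.
  rewrite le_eqVlt; apply/orP; left; apply/eqP; field.
  by rewrite !gt_eqF.
apply: le_trans s2 _; apply: leeD; last first.
  rewrite lee_fin; have M4 : M%:R ^+ 4 <= (n%:R / rmax ^+ 2) ^+ 2.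
    have P1 : 0 <= M%:R ^+ 2 :> R by exact: sqr_ge0.
    rewrite -[4%N]/(2 * 2)%N exprM; apply: lerXn2r => //; rewrite nnegrE//.
    exact: le_trans P1 M2.
  apply: (@le_trans _ _ (2 * (n%:R / rmax ^+ 2) ^+ 2 / n%:R ^+ 4)).
    by rewrite ler_wpM2r ?invr_ge0 ?exprn_ge0// ler_wpM2l.
  have -> : 2 * (n%:R / rmax ^+ 2) ^+ 2 / n%:R ^+ 4 = 2 / rmax ^+ 4 / n%:R / n%:R.
    by field; rewrite !gt_eqF.
  rewrite ler_pdivrMr// ler_peMr// ?divr_ge0 ?exprn_ge0//; exact: ltW.
apply: ppp_prob_mono => s bs [[Gs _] ev].
apply: (diam_event_of_windows (M := M) (rmin := rmin)) => //; lra.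
Qed.
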